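(* Let $v,q\in\mathbb{C}$ with $\operatorname{Re}(v+q)>0$ and $\operatorname{Re}(v)>-\tfrac12$, and let $x\neq 0$. Then $$I_{v}(q;x)=\frac{\left(\frac{x}{2}\right)^{v}2^{2v+q-\frac12}\,\Gamma(v+q)}{\sqrt{\pi}\,\Gamma\left(2v+q+\frac12\right)}\;{}_{1}F_{1}\left(v+q,\,2v+q+\tfrac12,\,2x\right),$$ where $I_v(q;x)$ is the extended modified Bessel function and ${}_1F_1$ is the confluent hypergeometric function.
   Context: The extended modified Bessel function is defined, for $\operatorname{Re}(v+q)>0$ and $\operatorname{Re}(v)>-\tfrac12$, by $$I_{v}(q;x)=\frac{\left(\frac{x}{2}\right)^{v}}{\sqrt{\pi}\,\Gamma\left(v+\frac12\right)}\int_{-1}^{1}(1-t^{2})^{v-\frac12}(1-t)^{q-\frac12}\exp(-x(t-1))\,dt .$$ The power $(x/2)^v$ is taken with the principal branch. The confluent hypergeometric function is ${}_1F_1(\alpha,\beta,x)=\sum_{n\ge 0}\frac{(\alpha)_n}{(\beta)_n}\frac{x^n}{n!}$, with $(\alpha)_n=\alpha(\alpha+1)\cdots(\alpha+n-1)$. *)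

(* Defs.v *)
(* MathComp world: MathComp-Analysis over an arbitrary realType, with the
   complex numbers R[i] of mathcomp-real-closed. *)
From HB Require Import structures.
From mathcomp Require Import all_boot all_order all_algebra.
From mathcomp Require Import all_classical all_reals all_analysis.
From mathcomp Require Import complex.

Set Implicit Arguments.
Unset Strict Implicit.
Unset Printing Implicit Defensive.

Import Order.TTheory GRing.Theory Num.Theory.
Import numFieldNormedType.Exports.

Local Open Scope classical_set_scope.
Local Open Scope ring_scope.
Local Open Scope complex_scope.

Section Defs.
Variable R : realType.
Implicit Types (z w a b v q x : R[i]) (D : set R) (f : R -> R[i]).

Definition cexp z : R[i] :=
  (expR (complex.Re z))%:C *
  (cos (complex.Im z) +i* sin (complex.Im z)).

(* The argument in ]-pi, pi]; the negative real axis gets pi. The value at 0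
   is irrelevant. *)
Definition carg z : R :=
  let theta := acos (complex.Re z / Normc.normc z) in
  if 0 <= complex.Im z then theta else - theta.

Definition clog z : R[i] := ln (Normc.normc z) +i* carg z.

(* Principal power; the conventions at base 0 are those of powR. *)
Definition cpow w z : R[i] :=
  if w == 0 then (z == 0)%:R else cexp (z * clog w).

Definition cintegral D f : R[i] :=
  (\int[lebesgue_measure]_(t in D) complex.Re (f t)) +i*
  (\int[lebesgue_measure]_(t in D) complex.Im (f t)).

(* Euler's integral: this is the Gamma function only on the half-plane
   Re z > 0. *)
Definition Gamma z : R[i] :=
  cintegral `]0, +oo[ (fun t => cpow t%:C (z - 1) * cexp (- t%:C)).

Definition pochhammer a n : R[i] := \prod_(k < n) (a + k%:R).

Definition hyp1F1 a b x : R[i] :=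
  lim ((fun n => \sum_(0 <= k < n)
          pochhammer a k / pochhammer b k * (x ^+ k / k`!%:R) : R[i]^o) @ \oo).

Definition ext_bessel_I v q x : R[i] :=
  cpow (x / 2) v / ((Num.sqrt (pi : R))%:C * Gamma (v + 2^-1)) *
  cintegral `[-1, 1] (fun t =>
    cpow (1 - t%:C ^+ 2) (v - 2^-1) * cpow (1 - t%:C) (q - 2^-1) *
    cexp (- x * (t%:C - 1))).

End Defs.

(* Main.v *)
Require Import Defs.
From mathcomp Require Import all_boot all_order all_algebra.
From mathcomp Require Import all_classical all_reals all_analysis.
From mathcomp Require Import measurable_realfun complex ring lra.

Set Implicit Arguments.
Unset Strict Implicit.
Unset Printing Implicit Defensive.

Import Order.TTheory GRing.Theory Num.Theory.
Import numFieldNormedType.Exports.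

Local Open Scope classical_set_scope.
Local Open Scope ring_scope.
Local Open Scope complex_scope.

(** Substituting t = 2 u - 1 in the defining integral turns it into
    2^(2v+q-1/2) times
      K(y) = int_0^1 u^(b-1) (1-u)^(a-1) exp(y(1-u)) du,
    with a = v+q, b = v+1/2 and y = 2x.  Expanding the exponential and
    integrating term by term gives
      K(y) = sum_n B(b, a+n) y^n / n!,
    where B is Euler's Beta integral (lemma [Beta_exp_1F1]).  Since
    B(b, a+n) = B(b, a) (a)_n / (a+b)_n, the sum is
    B(b, a) 1F1(a, a+b, y), and B(b, a) = Gamma(a) Gamma(b) / Gamma(a+b)
    cancels the factor Gamma(b) in the denominator.

    What this uses about Gamma, for complex arguments of positive real part, is
    proved from the integral representation:
    - the Beta formula Gamma(a) Gamma(b) = B(a, b) Gamma(a+b), by Fubini's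
      theorem and a rescaling of the inner integral ([GammaM_Beta]);
    - the functional equation Gamma(z+1) = z Gamma(z), which is the case b = 1
      of the Beta formula, as B(z, 1) = 1/z ([Gamma_add1]);
    - Gamma(z) <> 0 ([Gamma_neq0]), without which neither quotient would be
      meaningful.  By the functional equation a zero z would propagate to all
      z+n; but when Re z is large compared to (Im z)^2 the mass of
      t^(Re z - 1) exp(-t) concentrates near t = Re z, where the phase
      t^(i Im z) hardly varies, so the integral cannot vanish.

    Integrating term by term is legitimate because the Taylor remainder of
    exp(tz) is at most a constant times M^n / n!, uniformly for 0 <= t <= 1
    ([Taylor_cexp]), and the factor in front of it is integrable.

    The power functions are extended by 0 to the whole line ([cpospow]).  The
    Gamma and Beta integrals are then over R, domains of integration never have
    to be transported through a change of variables, and the convolution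
    underlying the Beta formula is a plain double integral. *)

(** * Complex numbers and the complex exponential *)

Section ComplexExponential.
Variable R : realType.
Implicit Types z w : R[i].

Lemma complexP z w :
  complex.Re z = complex.Re w -> complex.Im z = complex.Im w -> z = w.
Proof. by case: z w => [a b] [c d] /= -> ->. Qed.

Lemma cReM z w : complex.Re (z * w) =
  complex.Re z * complex.Re w - complex.Im z * complex.Im w.
Proof. by case: z w => [a b] [c d]. Qed.

Lemma cImM z w : complex.Im (z * w) =
  complex.Re z * complex.Im w + complex.Im z * complex.Re w.
Proof. by case: z w => [a b] [c d]. Qed.

Lemma cRe_realM (c : R) z : complex.Re (c%:C * z) = c * complex.Re z.
Proof. by rewrite cReM /= mul0r subr0. Qed.

Lemma cIm_realM (c : R) z : complex.Im (c%:C * z) = c * complex.Im z.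
Proof. by rewrite cImM /= mul0r addr0. Qed.

Lemma cReB z w : complex.Re (z - w) = complex.Re z - complex.Re w.
Proof. by case: z w => [a b] [c d]. Qed.

Lemma cImB z w : complex.Im (z - w) = complex.Im z - complex.Im w.
Proof. by case: z w => [a b] [c d]. Qed.

Lemma cReD z w : complex.Re (z + w) = complex.Re z + complex.Re w.
Proof. by case: z w => [a b] [c d]. Qed.

Lemma cImD z w : complex.Im (z + w) = complex.Im z + complex.Im w.
Proof. by case: z w => [a b] [c d]. Qed.

Lemma Re_nat n : complex.Re (n%:R : R[i]) = n%:R.
Proof. by elim: n => [//|n IH]; rewrite -natr1 cReD IH -natr1. Qed.

Lemma Im_nat n : complex.Im (n%:R : R[i]) = 0.
Proof. by elim: n => [//|n IH]; rewrite -natr1 cImD IH add0r. Qed.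

Lemma real_complex_nat n : (n%:R : R)%:C = n%:R :> R[i].
Proof. by apply: complexP; rewrite /= ?Re_nat ?Im_nat. Qed.

Lemma normc_ge0 z : 0 <= Normc.normc z.
Proof. by case: z => a b; exact: sqrtr_ge0. Qed.

Lemma Re_le_normc z : `|complex.Re z| <= Normc.normc z.
Proof.
by case: z => a b /=; rewrite -sqrtr_sqr ler_wsqrtr// lerDl sqr_ge0.
Qed.

Lemma Im_le_normc z : `|complex.Im z| <= Normc.normc z.
Proof.
by case: z => a b /=; rewrite -sqrtr_sqr ler_wsqrtr// lerDr sqr_ge0.
Qed.

Lemma normc_le_ReIm z : Normc.normc z <= `|complex.Re z| + `|complex.Im z|.
Proof.
case: z => a b /=; rewrite -(ger0_norm (addr_ge0 (normr_ge0 a) (normr_ge0 b))).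
rewrite -sqrtr_sqr ler_wsqrtr// sqrrD !real_normK ?num_real//.
by rewrite addrAC lerDl mulrn_wge0// mulr_ge0.
Qed.

Lemma normc_real (r : R) : Normc.normc r%:C = `|r|.
Proof. by rewrite /= expr0n addr0 sqrtr_sqr. Qed.

Lemma Re_cexp z : complex.Re (cexp z) = expR (complex.Re z) * cos
  (complex.Im z).
Proof. by rewrite /cexp cRe_realM. Qed.

Lemma Im_cexp z : complex.Im (cexp z) = expR (complex.Re z) * sin
  (complex.Im z).
Proof. by rewrite /cexp cIm_realM. Qed.

Lemma normc_cexp z : Normc.normc (cexp z) = expR (complex.Re z).
Proof.
rewrite /cexp Normc.normcM normc_real ger0_norm ?expR_ge0//= cos2Dsin2.
by rewrite sqrtr1 mulr1.
Qed.

Lemma cexpD z w : cexp (z + w) = cexp z * cexp w.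
Proof.
apply: complexP.
  by rewrite Re_cexp [RHS]cReM !(Re_cexp, Im_cexp) cReD cImD expRD cosD; ring.
by rewrite Im_cexp [RHS]cImM !(Re_cexp, Im_cexp) cReD cImD expRD sinD; ring.
Qed.

Lemma cexp0 : cexp 0 = 1 :> R[i].
Proof. by apply: complexP; rewrite ?Re_cexp ?Im_cexp /= expR0 mul1r ?cos0 ?sin0.
  Qed.

Lemma cexp_real (r : R) : cexp r%:C = (expR r)%:C.
Proof. by apply: complexP; rewrite ?Re_cexp ?Im_cexp /= ?cos0 ?sin0 ?mulr1
  ?mulr0. Qed.

Lemma cexp_neq0 z : cexp z != 0.
Proof.
apply/negP => /eqP z0; have := normc_cexp z; rewrite z0 Normc.normc0 =>
  /esym/eqP.
by rewrite gt_eqF// expR_gt0.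
Qed.

Lemma cpow_gt0 (t : R) z : 0 < t -> cpow t%:C z = cexp (z * (ln t)%:C).
Proof.
move=> t0; rewrite /cpow eq_complex /= eqxx andbT gt_eqF//.
congr (cexp (z * _)); rewrite /clog normc_real gtr0_norm//.
by congr Complex; rewrite /carg normc_real /= lexx gtr0_norm// divff ?acos1//
  gt_eqF.
Qed.

End ComplexExponential.

(** * Integration of complex-valued functions *)

Section ComplexIntegral.
Local Open Scope ereal_scope.
Context d (T : measurableType d) (R : realType).
Variable mu : {measure set T -> \bar R}.
Implicit Types (f g : T -> R[i]) (h : T -> R).

Definition cmeasurable f :=
  measurable_fun setT (fun x => complex.Re (f x)) /\
  measurable_fun setT (fun x => complex.Im (f x)).

Definition cintegrable f :=
  mu.-integrable setT (fun x => (complex.Re (f x))%:E) /\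
  mu.-integrable setT (fun x => (complex.Im (f x))%:E).

Definition cint f : R[i] :=
  (\int[mu]_x complex.Re (f x))%R +i* (\int[mu]_x complex.Im (f x))%R.

Lemma cmeasurable_cst (z : R[i]) : cmeasurable (fun=> z).
Proof. by split; exact: measurable_cst. Qed.

Lemma cmeasurable_real h : measurable_fun setT h ->
  cmeasurable (fun x => (h x)%:C).
Proof. by move=> mh; split => //=; exact: measurable_cst. Qed.

Lemma cmeasurableM f g : cmeasurable f -> cmeasurable g ->
  cmeasurable (fun x => f x * g x)%R.
Proof.
move=> [f1 f2] [g1 g2]; split.
  under eq_fun do rewrite cReM.
  by apply: measurable_funB; exact: measurable_funM.
under eq_fun do rewrite cImM.
by apply: measurable_funD; exact: measurable_funM.
Qed.

Lemma cmeasurable_comp d' (X : measurableType d') (g : X -> T) f :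
  cmeasurable f -> measurable_fun setT g ->
  measurable_fun setT (fun x => complex.Re (f (g x))) /\
  measurable_fun setT (fun x => complex.Im (f (g x))).
Proof.
move=> [f1 f2] mg; split.
  exact: (measurableT_comp f1).
exact: (measurableT_comp f2).
Qed.

Lemma cmeasurable_if (b : T -> bool) f : measurable_fun setT b ->
  cmeasurable f -> cmeasurable (fun x => if b x then f x else 0%R).
Proof.
move=> mb [f1 f2]; split.
  rewrite (_ : (fun _ => _) = fun x => if b x then complex.Re (f x) else 0%R).
    exact: measurable_fun_ifT.
  by apply/funext => x; case: ifP.
rewrite (_ : (fun _ => _) = fun x => if b x then complex.Im (f x) else 0%R).
  exact: measurable_fun_ifT.
by apply/funext => x; case: ifP.
Qed.

Lemma cmeasurable_cexp f : cmeasurable f -> cmeasurable (fun x => cexp (f x)).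
Proof.
move=> [f1 f2]; split.
  under eq_fun do rewrite Re_cexp.
  apply: measurable_funM; first exact: measurableT_comp.
  by apply: measurableT_comp => //; apply: continuous_measurable_fun;
    exact: continuous_cos.
under eq_fun do rewrite Im_cexp.
apply: measurable_funM; first exact: measurableT_comp.
by apply: measurableT_comp => //; apply: continuous_measurable_fun;
  exact: continuous_sin.
Qed.

Lemma cintegrable_dominated f h : cmeasurable f ->
  mu.-integrable setT (EFin \o h) -> (forall x, Normc.normc (f x) <= h x)%R ->
  cintegrable f.
Proof.
move=> [f1 f2] ih fh; split; apply: le_integrable ih => //.
- exact/measurable_EFinP.
- move=> x _ /=; rewrite lee_fin (le_trans (Re_le_normc _))//.
  by rewrite (le_trans (fh x))// ler_norm.
- exact/measurable_EFinP.
- move=> x _ /=; rewrite lee_fin (le_trans (Im_le_normc _))//.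
  by rewrite (le_trans (fh x))// ler_norm.
Qed.

Lemma eq_cint f g : f =1 g -> cint f = cint g.
Proof. by move=> fg; congr cint; apply/funext. Qed.

Lemma cintegrableM (c : R[i]) f : cintegrable f ->
  cintegrable (fun x => c * f x)%R.
Proof.
move=> [f1 f2]; split.
  under eq_fun do rewrite cReM EFinB !EFinM.
  by apply: integrableB => //; exact: integrableZl.
under eq_fun do rewrite cImM EFinD !EFinM.
by apply: integrableD => //; exact: integrableZl.
Qed.

Lemma cintZ (c : R[i]) f : cintegrable f ->
  cint (fun x => c * f x)%R = (c * cint f)%R.
Proof.
move=> [f1 f2]; have i (r : R) h : mu.-integrable setT (EFin \o h) ->
    mu.-integrable setT (EFin \o (fun x => r * h x)%R).
  by move=> ih; have := integrableZl measurableT r ih.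
apply: complexP; rewrite /= ?cReM ?cImM /=.
  under eq_Rintegral do rewrite cReM.
  by rewrite RintegralB// ?RintegralZl//; exact: i.
under eq_Rintegral do rewrite cImM.
by rewrite RintegralD// ?RintegralZl//; exact: i.
Qed.

Lemma cintegrableB f g : cintegrable f -> cintegrable g ->
  cintegrable (fun x => f x - g x)%R.
Proof.
move=> [f1 f2] [g1 g2]; split.
  by under eq_fun do rewrite cReB EFinB; exact: integrableB.
by under eq_fun do rewrite cImB EFinB; exact: integrableB.
Qed.

Lemma cintegrableD f g : cintegrable f -> cintegrable g ->
  cintegrable (fun x => f x + g x)%R.
Proof.
move=> [f1 f2] [g1 g2]; split.
  by under eq_fun do rewrite cReD EFinD; exact: integrableD.
by under eq_fun do rewrite cImD EFinD; exact: integrableD.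
Qed.

Lemma cintB f g : cintegrable f -> cintegrable g ->
  cint (fun x => f x - g x)%R = (cint f - cint g)%R.
Proof.
move=> [f1 f2] [g1 g2]; apply: complexP; rewrite ?cReB ?cImB /=.
  by under eq_Rintegral do rewrite cReB; rewrite RintegralB.
by under eq_Rintegral do rewrite cImB; rewrite RintegralB.
Qed.

Lemma cintD f g : cintegrable f -> cintegrable g ->
  cint (fun x => f x + g x)%R = (cint f + cint g)%R.
Proof.
move=> [f1 f2] [g1 g2]; apply: complexP; rewrite ?cReD ?cImD /=.
  by under eq_Rintegral do rewrite cReD; rewrite RintegralD.
by under eq_Rintegral do rewrite cImD; rewrite RintegralD.
Qed.

Lemma cintegrable_sum n (F : nat -> T -> R[i]) :
  (forall k, cintegrable (F k)) ->
  cintegrable (fun x => \sum_(0 <= k < n) F k x)%R /\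
  cint (fun x => \sum_(0 <= k < n) F k x)%R = (\sum_(0 <= k < n) cint (F k))%R.
Proof.
move=> iF; elim: n => [|n [IH1 IH2]].
  under eq_fun do rewrite big_nil; rewrite big_nil; split.
    by split; exact: integrable0.
  by apply: complexP; rewrite /= Rintegral_cst//= mul0r.
under eq_fun do rewrite big_nat_recr//=.
split; first exact: cintegrableD.
by rewrite big_nat_recr//= cintD// IH2.
Qed.

Lemma normr_cint_le f h : cintegrable f -> mu.-integrable setT (EFin \o h) ->
  (forall x, Normc.normc (f x) <= h x)%R ->
  (`|complex.Re (cint f)| <= \int[mu]_x h x)%R /\
  (`|complex.Im (cint f)| <= \int[mu]_x h x)%R.
Proof.
move=> [f1 f2] ih fh; split => /=;
  (apply: (le_trans (le_normr_Rintegral measurableT _)) => //);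
  apply: le_Rintegral => //; try exact: integrable_norm.
- by move=> x _; apply: le_trans (fh x); exact: Re_le_normc.
- by move=> x _; apply: le_trans (fh x); exact: Im_le_normc.
Qed.

End ComplexIntegral.

(** * Fubini's theorem *)

Section Fubini.
Local Open Scope ereal_scope.
Context d1 d2 (T1 : measurableType d1) (T2 : measurableType d2) (R : realType).
Variable m1 : {sigma_finite_measure set T1 -> \bar R}.
Variable m2 : {sigma_finite_measure set T2 -> \bar R}.

Let measurable_fine_EFin d (T : measurableType d) (F : T -> \bar R) :
  measurable_fun setT F -> measurable_fun setT (fun x => (fine (F x))%:E).
Proof.
by move=> mF; apply/measurable_EFinP; apply: (measurableT_comp _ mF);
  exact: fine_measurable.
Qed.

(** The inner integrals are real numbers obtained by truncating extended reals
    with [fine]; this is harmless because almost every slice is integrable. *)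
Lemma RFubini (h : T1 * T2 -> R) :
  (m1 \x m2).-integrable setT (EFin \o h) ->
  (\int[m1]_x \int[m2]_y h (x, y) = \int[m2]_y \int[m1]_x h (x, y))%R.
Proof.
move=> ih; rewrite /Rintegral; congr fine.
transitivity (\int[m1]_x \int[m2]_y (h (x, y))%:E).
  apply: ae_eq_integral => //.
  - exact: (measurable_fine_EFin (measurable_fubini_F ih)).
  - exact: (measurable_fubini_F ih).
  - apply: filterS (ae_integrable1 ih) => x /= ihx _.
    by rewrite fineK//; exact: integrable_fin_num.
rewrite (Fubini ih).
apply: ae_eq_integral => //.
- exact: (measurable_fubini_G ih).
- exact: (measurable_fine_EFin (measurable_fubini_G ih)).
- apply: filterS (ae_integrable2 ih) => x /= ihx _.
  by rewrite fineK//; exact: integrable_fin_num.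
Qed.

Lemma cFubini (f : T1 * T2 -> R[i]) : cintegrable (m1 \x m2) f ->
  cint m1 (fun x => cint m2 (fun y => f (x, y))) =
  cint m2 (fun y => cint m1 (fun x => f (x, y))).
Proof.
by move=> [f1 f2]; apply: complexP; rewrite /=;
  [exact: (RFubini f1)|exact: (RFubini f2)].
Qed.

End Fubini.

(** * Affine changes of variable *)

Section Affine.
Local Open Scope ereal_scope.
Variable R : realType.
Notation mu := (@lebesgue_measure R).
Variables (c e : R).
Hypothesis c0 : (0 < c)%R.

Let phi : measurableTypeR R -> measurableTypeR R := fun x => (c * x + e)%R.

Let mphi : measurable_fun setT phi.
Proof. by apply: measurable_funD => //; exact: measurable_funM. Qed.

(* The image measure is abstracted together with its defining equation, so that
   the measurability proof in its measure structure stays out of sight. *)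
Let image_measure : {m : {measure set (measurableTypeR R) -> \bar R} |
  m = pushforward mu phi :> (set (measurableTypeR R) -> \bar R)}.
Proof.
by exists (measure_function_pushforward__canonical__measure_function_Measure mu
  mphi).
Qed.

Let nu := sval image_measure.

Let nuE : nu = pushforward mu phi :> (set (measurableTypeR R) -> \bar R).
Proof. exact: (svalP image_measure). Qed.

(* Two Borel measures that agree on the half-open intervals are equal. *)
Let affine_measure (A : set (measurableTypeR R)) : measurable A ->
  mu A = mscale (NngNum (ltW c0)) nu A.
Proof.
apply: (@lebesgue_measure_unique R (mscale (NngNum (ltW c0)) nu)) =>
  _ [[a b] _ <-].
transitivity (c%:E * mu (phi @^-1` `]a, b]%classic)); last first.
  exact: (congr1 (fun m => c%:E * m _) (esym nuE)).
have -> : phi @^-1` `]a, b]%classic = `]((a - e) / c)%R,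
  ((b - e) / c)%R]%classic.
  apply/seteqP; split=> x /=; rewrite !in_itv/= ltr_pdivrMr// ler_pdivlMr//
    /phi;
    by rewrite ltrBlDr lerBrDr mulrC.
rewrite !lebesgue_measure_itv/= !lte_fin ltr_pM2r ?invr_gt0// ltrBlDr subrK.
case: ifPn => _; last by rewrite mule0.
by rewrite -!EFinB -EFinM; congr EFin; field; rewrite gt_eqF.
Qed.

Lemma ge0_integral_affine (f : R -> \bar R) : measurable_fun setT f ->
  (forall x, 0 <= f x) ->
  \int[mu]_x f x = c%:E * \int[mu]_x f (c * x + e)%R.
Proof.
move=> mf f0; rewrite (eq_measure_integral (mscale (NngNum (ltW c0)) nu));
  last first.
  by move=> A mA _; exact: affine_measure.
rewrite ge0_integral_mscale//=; congr (_ * _).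
by rewrite nuE ge0_integral_pushforward.
Qed.

Lemma integrable_affine (h : R -> R) : mu.-integrable setT (EFin \o h) ->
  mu.-integrable setT (EFin \o (fun x => h (c * x + e)%R)).
Proof.
move=> /integrableP[mh ih]; apply/integrableP; split.
  by apply: (measurableT_comp mh).
move: ih; rewrite ge0_integral_affine//; last exact: measurableT_comp.
rewrite [X in _ -> X < _](_ : _ = \int[mu]_x `|(EFin \o h) (c * x + e)%R|)//.
case: (\int[mu]_x _) (@integral_ge0 _ _ _ mu setT (fun x =>
  `|(EFin \o h) (c * x + e)%R|)
  (fun x _ => abse_ge0 _)) => //=; first by move=> *; exact: ltry.
by rewrite gt0_muley ?lte_fin.
Qed.

Lemma Rintegral_affine (h : R -> R) : mu.-integrable setT (EFin \o h) ->
  (\int[mu]_x h x = c * \int[mu]_x h (c * x + e))%R.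
Proof.
move=> ih; pose k x := h (c * x + e)%R.
have ik : mu.-integrable setT (EFin \o k) by exact: integrable_affine.
have mh := measurable_int mu ih.
have Ep : \int[mu]_x (EFin \o h)^\+ x = c%:E * \int[mu]_x (EFin \o k)^\+ x.
  rewrite ge0_integral_affine//; last exact: measurable_funepos.
  by rewrite !unlock.
have En : \int[mu]_x (EFin \o h)^\- x = c%:E * \int[mu]_x (EFin \o k)^\- x.
  rewrite ge0_integral_affine//; last exact: measurable_funeneg.
  by rewrite !unlock.
have E : \int[mu]_x (EFin \o h) x = c%:E * \int[mu]_x (EFin \o k) x.
  rewrite integralE [in RHS]integralE Ep En [RHS]muleBr//.
  by apply: fin_num_adde_defr; apply: integrable_fin_num => //;
    exact: integrable_funepos.
rewrite /Rintegral [X in fine X]E fineM//.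
exact: integrable_fin_num.
Qed.

Lemma cintegrable_affine (f : R -> R[i]) : cintegrable mu f ->
  cintegrable mu (fun x => f (c * x + e)%R).
Proof.
by move=> [f1 f2]; split; [exact: (integrable_affine f1)|
  exact: (integrable_affine f2)].
Qed.

Lemma cint_affine (f : R -> R[i]) : cintegrable mu f ->
  cint mu f = (c%:C * cint mu (fun x => f (c * x + e)))%R.
Proof.
move=> [f1 f2]; apply: complexP.
  by rewrite [RHS]cRe_realM; exact: (Rintegral_affine f1).
by rewrite [RHS]cIm_realM; exact: (Rintegral_affine f2).
Qed.

End Affine.

(** * Powers supported on the positive half-line *)

Section PowerKernel.
Variable R : realType.
Notation mu := (@lebesgue_measure R).
Implicit Types (s t : R) (z : R[i]).

(** The exponent is s - 1, so that the parameter is the argument of Gamma and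
    Beta; [cpospow] follows the same convention. *)
Definition rpospow s t : R := if 0 < t then expR ((s - 1) * ln t) else 0.

Definition cpospow z t : R[i] :=
  if 0 < t then cexp ((z - 1) * (ln t)%:C) else 0.

Lemma rpospow_ge0 s t : 0 <= rpospow s t.
Proof. by rewrite /rpospow; case: ifP => // _; exact: expR_ge0. Qed.

Lemma cpospow_real s t : cpospow s%:C t = (rpospow s t)%:C.
Proof.
rewrite /cpospow /rpospow; case: ifP => // _; rewrite -cexp_real; congr cexp.
by rewrite rmorphM rmorphB.
Qed.

Lemma normc_cpospow z t : Normc.normc (cpospow z t) = rpospow (complex.Re z) t.
Proof.
rewrite /cpospow /rpospow; case: ifP => _; last exact: Normc.normc0.
by rewrite normc_cexp mulrC cRe_realM cReB mulrC.
Qed.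

Lemma mulr_cpospow z t : t%:C * cpospow z t = cpospow (z + 1) t.
Proof.
rewrite /cpospow; case: ifP => t0; last by rewrite mulr0.
rewrite -{1}(lnK t0) -cexp_real -cexpD; congr cexp; ring.
Qed.

Lemma cpospow_scale z c t : 0 < c ->
  cpospow z (c * t) = cexp ((z - 1) * (ln c)%:C) * cpospow z t.
Proof.
move=> c0; rewrite /cpospow pmulr_rgt0//; case: ifP => t0;
  last by rewrite mulr0.
by rewrite -cexpD lnM// rmorphD mulrDr.
Qed.

Lemma rpospow_scale s c t : 0 < c ->
  rpospow s (c * t) = expR ((s - 1) * ln c) * rpospow s t.
Proof.
move=> c0; rewrite /rpospow pmulr_rgt0//; case: ifP => t0;
  last by rewrite mulr0.
by rewrite -expRD lnM// mulrDr.
Qed.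

Lemma measurable_rpospow s : measurable_fun setT (rpospow s).
Proof.
apply: measurable_fun_ifT => //; first exact: measurable_fun_ltr.
by apply: measurableT_comp => //; apply: measurable_funM => //;
  exact: measurable_ln.
Qed.

Lemma cmeasurable_cpospow z :
  cmeasurable (cpospow z : measurableTypeR R -> R[i]).
Proof.
apply: cmeasurable_if; first exact: measurable_fun_ltr.
apply: cmeasurable_cexp; apply: cmeasurableM; first exact: cmeasurable_cst.
by apply: cmeasurable_real; exact: measurable_ln.
Qed.

Lemma GammaE z : Gamma z = cint mu (fun t => cpospow z t * (expR (- t))%:C).
Proof.
rewrite /Gamma /cintegral /cint; congr Complex; rewrite Rintegral_mkcond;
  apply: eq_Rintegral => t _; rewrite patchE; (case: ifPn;
    [rewrite inE/= in_itv/= andbT => t0;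
      rewrite cpow_gt0// /cpospow t0 -cexp_real rmorphN//
    |rewrite notin_setE/= in_itv/= andbT => /negP/negbTE t0;
      rewrite /cpospow t0 mul0r//]).
Qed.

End PowerKernel.

(** * Primitives of complex powers *)

Section PowerIntegral.
Variable R : realType.
Notation mu := (@lebesgue_measure R).
Implicit Types (s t : R) (z : R[i]).

(** The phase [p] makes one formula serve for both parts of t^(x+iy): [p = 0]
    is the real part and [p = - pi / 2] the imaginary part. *)
Lemma is_derive_powcos (x y p t : R) : 0 < t ->
  is_derive t 1 (fun t => expR (x * ln t) * cos (y * ln t + p))
    (expR ((x - 1) * ln t) * (x * cos (y * ln t + p) - y * sin (y * ln t + p))).
Proof.
move=> t0; have dln := is_derive1_ln t0.
apply: is_derive_eq.
have -> : expR ((x - 1) * ln t) = expR (x * ln t) * t^-1.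
  by rewrite mulrBl mul1r expRD expRN lnK.
rewrite /GRing.scale/=; ring.
Qed.

Lemma FTC_powcos (x y p a b : R) : 0 < a -> a < b ->
  \int[mu]_(t in `[a, b]) (expR ((x - 1) * ln t) *
     (x * cos (y * ln t + p) - y * sin (y * ln t + p))) =
  expR (x * ln b) * cos (y * ln b + p) - expR (x * ln a) * cos (y * ln a + p)
  /\ mu.-integrable `[a, b] (fun t => (expR ((x - 1) * ln t) *
     (x * cos (y * ln t + p) - y * sin (y * ln t + p)))%:E).
Proof.
move=> a0 ab.
pose f t := expR ((x - 1) * ln t) * (x * cos (y * ln t + p) - y * sin
  (y * ln t + p)).
pose F t := expR (x * ln t) * cos (y * ln t + p).
have dF t : 0 < t -> is_derive t 1 F (f t) by exact: is_derive_powcos.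
have cF t : 0 < t -> {for t, continuous F}.
  by move=> /dF[dF' _]; exact/differentiable_continuous/derivable1_diffP.
have sinE (u : R) : sin u = cos (u - pi / 2).
  by rewrite cosB cos_pihalf sin_pihalf mulr0 mulr1 add0r.
(* f is itself a combination of two functions of the same shape as F. *)
have df t : 0 < t -> derivable f t 1.
  move=> t0.
  have -> : f = (fun t => x *: (expR ((x - 1) * ln t) * cos (y * ln t + p))
    - y *: (expR ((x - 1) * ln t) * cos (y * ln t + (p - pi / 2)))) :> (R -> R).
    by apply/funext => u; rewrite /f sinE addrA /GRing.scale/=; ring.
  apply: derivableB; apply: derivableZ.
    by have [] := is_derive_powcos (x - 1) y p t0.
  by have [] := is_derive_powcos (x - 1) y (p - pi / 2) t0.
have pos t : t \in `[a, b] -> 0 < t.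
  by rewrite in_itv/= => /andP[/(lt_le_trans a0)].
have cf : {within `[a, b], continuous f}.
  by apply: derivable_within_continuous => t /pos; exact: df.
split; last first.
  by apply: continuous_compact_integrable => //; exact: segment_compact.
rewrite /Rintegral (@continuous_FTC2 _ f F)//.
- split.
  + by move=> t tab; have /dF[] : 0 < t by apply: pos; apply: subset_itv_oo_cc.
  + by apply: cvg_at_right_filter; exact: cF.
  + by apply: cvg_at_left_filter; apply: cF; exact: lt_trans ab.
- move=> t tab; rewrite derive1E.
  by have /dF[_ ->] : 0 < t by apply: pos; apply: subset_itv_oo_cc.
Qed.

End PowerIntegral.

(** * The integral of a power over the unit interval *)

Section TruncatedPower.
Variable R : realType.
Notation mu := (@lebesgue_measure R).
Implicit Types (s t : R) (z : R[i]).

(** The bound does not depend on [a], so that monotone convergence applies as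
    [a] tends to 0. *)
Lemma integral_power_itv s a : 0 < s -> 0 < a -> a < 1 ->
  (\int[mu]_(t in `[a, 1%R]) (rpospow s t)%:E <= (s^-1)%:E)%E.
Proof.
move=> s0 a0 a1; have [] := @FTC_powcos R s 0 0 a 1 a0 a1.
have E : {in `[a, 1]%classic, (fun t => expR ((s - 1) * ln t) *
     (s * cos (0 * ln t + 0) - 0 * sin (0 * ln t + 0))) =1 fun t =>
       s * rpospow s t}.
  move=> t; rewrite inE/= in_itv/= => /andP[/(lt_le_trans a0) t0 _].
  by rewrite /rpospow t0 !mul0r addr0 cos0; ring.
rewrite (@eq_Rintegral _ _ R mu _ (fun t => s * rpospow s t)) // => I1 i1.
have i2 : mu.-integrable `[a, 1] (EFin \o (fun t => s * rpospow s t)).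
  by apply: eq_integrable i1 => // t ta; rewrite /= E.
have i3 : mu.-integrable `[a, 1] (EFin \o rpospow s).
  have := @integrableZl _ _ _ mu `[a, 1]%classic (measurable_itv _) s^-1 _ i2.
  by apply: eq_integrable => // t ta; rewrite /= -EFinM mulrA mulVf ?mul1r//
    gt_eqF.
move: I1; rewrite RintegralZl// !mul0r !addr0 cos0 ln1 mulr0 expR0 !mulr1 => I1.
rewrite -[leLHS]fineK; last exact: integrable_fin_num.
rewrite lee_fin -(ler_pM2l s0) mulfV ?gt_eqF// I1.
by rewrite gerBl expR_ge0.
Qed.

Lemma bigcup_itv_oc01 :
  \bigcup_n `[n.+2%:R^-1, 1]%classic = `]0 : R, 1]%classic.
Proof.
apply/seteqP; split => t /=.
  move=> [n _] /=; rewrite !in_itv/= => /andP[nt ->]; rewrite andbT.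
  by apply: lt_le_trans nt; rewrite invr_gt0.
rewrite in_itv/= => /andP[t0 t1].
exists (Num.truncn t^-1) => //=; rewrite in_itv/= t1 andbT.
rewrite -[leRHS]invrK lef_pV2 ?posrE ?invr_gt0//.
apply/ltW/(lt_trans (truncnS_gt _)).
by rewrite ltr_nat.
Qed.

Lemma integrable_rpospow01 s : 0 < s ->
  mu.-integrable setT (EFin \o (rpospow s \_ `]0, 1])).
Proof.
move=> s0; have ms := @measurable_rpospow R s.
rewrite -restrict_EFin; apply/integrable_restrict => //; rewrite setTI.
apply/integrableP; split; first by apply/measurable_EFinP;
  exact: measurable_funTS.
apply: (@le_lt_trans _ _ (s^-1)%:E); last exact: ltry.
rewrite -bigcup_itv_oc01.
under eq_integral => t _ do rewrite /= ger0_norm ?rpospow_ge0//.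
have nd : nondecreasing_seq (fun n => `[n.+2%:R^-1, 1]%classic : set R).
  move=> m n mn; rewrite subsetEset => t /=; rewrite !in_itv/= => /andP[mt ->].
  rewrite andbT (le_trans _ mt)// lef_pV2 ?posrE// ler_nat !ltnS; exact: mn.
have cv : (\int[mu]_(t in `[(n.+2%:R^-1)%R, 1%R]) (rpospow s t)%:E)%E
    @[n --> \oo] -->
    (\int[mu]_(t in \bigcup_n `[(n.+2%:R^-1)%R, 1%R]%classic)
      (rpospow s t)%:E)%E.
  apply: ge0_nondecreasing_set_cvg_integral => //.
  - by move=> n; apply/measurable_EFinP; exact: measurable_funTS.
  - by move=> n t _; rewrite lee_fin rpospow_ge0.
rewrite -(cvg_lim _ cv)//; apply: lime_le; first exact: cvgP cv.
apply: nearW => n; apply: integral_power_itv => //.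
by rewrite invf_lt1// ltr1n.
Qed.

(* The value of int_0^1 t^(z-1) dt is found without a limit at 0.  With
   J b = int_0^b t^(z-1) dt, the substitution t -> t/2 gives J 2 = 2^z J 1,
   and the primitive on [1, 2] gives z (J 2 - J 1) = 2^z - 1; as
   2^z <> 1, these two relations determine J 1. *)
Let h z b t : R[i] := if t < b then cpospow z t else 0.

Let mh z b : cmeasurable (h z b : measurableTypeR R -> R[i]).
Proof.
apply: cmeasurable_if; last exact: cmeasurable_cpospow.
exact: measurable_fun_ltr.
Qed.

Let ih1 z : 0 < complex.Re z -> cintegrable mu (h z 1).
Proof.
move=> z0; apply: cintegrable_dominated (mh _ _) (integrable_rpospow01 z0) _ =>
  t.
rewrite patchE /h; case: ifPn => t1; last first.
  by rewrite Normc.normc0; case: ifP => // _; exact: rpospow_ge0.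
rewrite normc_cpospow; case: ifPn => //.
rewrite notin_setE/= in_itv/= (ltW t1) andbT => /negP/negbTE t0.
by rewrite /rpospow t0.
Qed.

Let h_scale z t :
  h z 1 (2^-1 * t + 0) = cexp ((z - 1) * (ln 2^-1)%:C) * h z 2 t.
Proof.
rewrite addr0 /h -(ltr_pM2l (@ltr0n R 2)) mulrA divff// mul1r mulr1.
by case: ifP => _; rewrite ?mulr0// cpospow_scale.
Qed.

Let ih2 z : 0 < complex.Re z -> cintegrable mu (h z 2).
Proof.
move=> z0; have := cintegrableM (cexp ((z - 1) * (ln 2^-1)%:C))^-1
  (cintegrable_affine (0 : R) (_ : 0 < 2^-1 :> R) (ih1 z0)).
move=> /(_ (ltac:(by rewrite invr_gt0))).
congr cintegrable; apply/funext => t.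
by rewrite h_scale mulrA mulVf ?mul1r// cexp_neq0.
Qed.

Let h_diff z : 0 < complex.Re z ->
  z * (cint mu (h z 2) - cint mu (h z 1)) = cexp (z * (ln 2)%:C) - 1.
Proof.
move=> z0; have i1 := ih1 z0; have i2 := ih2 z0.
have i21 := cintegrableB i2 i1.
rewrite -cintB// -cintZ//.
have hE t : z * (h z 2 t - h z 1 t) =
    if t \in `[1, 2[%classic then z * cexp ((z - 1) * (ln t)%:C) else 0.
  rewrite mem_setE in_itv/= /h; have [t1|t1] := ltP t 1.
    by rewrite (lt_trans t1) ?ltr1n// subrr mulr0.
  rewrite subr0; case: ifPn => _; rewrite ?mulr0//.
  by rewrite /cpospow (lt_le_trans _ t1).
case: z z0 i1 i2 i21 hE => x y /= x0 i1 i2 i21 hE.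
have patchi (f : R -> R) : mu.-integrable `[1, 2] (EFin \o f) ->
    \int[mu]_t (f \_ `[1, 2[) t = \int[mu]_(t in `[1, 2]) f t.
  move=> fi; rewrite -Rintegral_mkcond Rintegral_itv_bndo_bndc//.
  by apply: integrableS fi => //; exact: subset_itv_co_cc.
have ltr12 : (1 < 2 :> R) by rewrite ltr1n.
apply: complexP.
  rewrite cReB Re_cexp cReM cImM /= !mulr0 ?subr0 ?add0r.
  have [e i] := @FTC_powcos R x y 0 1 2 ltr01 ltr12.
  move: e; rewrite ln1 !mulr0 !addr0 expR0 cos0 mulr1 => <-.
  rewrite -patchi//; apply: eq_Rintegral => t _.
  rewrite hE patchE; case: ifPn => // t12.
  by rewrite cReM Re_cexp Im_cexp cReM cImM cReB cImB /= ?(mulr0, subr0, addr0,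
    add0r); ring.
have [e i] := @FTC_powcos R x y (- (pi / 2)) 1 2 ltr01 ltr12.
rewrite cImB Im_cexp cReM cImM /= !mulr0 !subr0 add0r.
have c2 (u : R) : cos (u - pi / 2) = sin u.
  by rewrite cosB cos_pihalf sin_pihalf mulr0 mulr1 add0r.
have s2 (u : R) : sin (u - pi / 2) = - cos u.
  by rewrite sinB cos_pihalf sin_pihalf mulr0 mulr1 sub0r.
move: e; rewrite ln1 !mulr0 !c2 sin0 mulr0 subr0 => <-.
rewrite -patchi//; apply: eq_Rintegral => t _.
rewrite hE patchE; case: ifPn => // t12.
rewrite c2 s2 cImM Re_cexp Im_cexp cReM cImM cReB cImB /= ?(mulr0, subr0, addr0,
  add0r); ring.
Qed.

(** This is z B(z, 1) = 1: the second factor is the indicator of ]-oo, 1[. *)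
Lemma cint_power01 z : 0 < complex.Re z ->
  z * cint mu (fun t => cpospow z t * cpospow 1 (1 - t)) = 1.
Proof.
move=> z0; rewrite (_ : (fun _ => _) = h z 1); last first.
  apply/funext => t; rewrite /h [cpospow 1 _]/cpospow subr_gt0; case: ifP;
    rewrite ?mulr0//.
  by rewrite subrr mul0r cexp0 mulr1.
have e := h_diff z0.
have : cint mu (h z 1) = cexp (z * (ln 2^-1)%:C) * cint mu (h z 2).
  have half_gt0 : 0 < 2^-1 :> R by rewrite invr_gt0.
  rewrite (cint_affine 0 half_gt0 (ih1 z0)).
  rewrite (_ : (fun _ => _) = fun t => cexp ((z - 1) * (ln 2^-1)%:C) * h z 2 t).
    rewrite cintZ; last exact: ih2.
    rewrite mulrA; congr (_ * _).
    rewrite -{1}[2^-1](@lnK R) ?posrE ?invr_gt0// -cexp_real -cexpD; congr cexp.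
    by ring.
  by apply/funext => t; exact: h_scale.
set J := cint mu (h z 1) in e *; set K := cint mu (h z 2) in e * => JK.
have ne1 : cexp (z * (ln 2)%:C) != 1.
  apply/negP => /eqP /(congr1 (@Normc.normc _));
    rewrite normc_cexp cReM /= mulr0 subr0.
  rewrite expr0n addr0 expr1n sqrtr1 => /eqP;
    rewrite gt_eqF// -[ltLHS]expR0 ltr_expR mulr_gt0//.
  by rewrite ln_gt0// ltr1n.
have JK' : K = cexp (z * (ln 2)%:C) * J.
  rewrite JK mulrA -cexpD -mulrDr -rmorphD/= lnV ?posrE// subrr mulr0 cexp0.
  by rewrite mul1r.
move: e; rewrite JK' => /eqP; rewrite -{2}[J]mul1r -mulrBl mulrCA -subr_eq0.
rewrite -{2}[_ - 1]mulr1 -mulrBr mulf_eq0 subr_eq0 (negbTE ne1) /= subr_eq0.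
by move=> /eqP.
Qed.

End TruncatedPower.

(** * Convergence of the Gamma integral *)

Section GammaBeta.
Variable R : realType.
Notation mu := (@lebesgue_measure R).
Implicit Types (s t : R) (z : R[i]).

(** From ln u < u at u = t / (2M), with M = |s| + 1: the factor 2M is what
    leaves exp(-t/2) of the decay. *)
Lemma rpospow_expN_le s t : 1 <= t ->
  rpospow s t * expR (- t) <=
  expR ((`|s| + 1) * ln (2 * (`|s| + 1))) * expR (- 2^-1 * t).
Proof.
move=> t1; have t0 : 0 < t by exact: lt_le_trans t1.
have lnt : 0 <= ln t by exact: ln_ge0.
rewrite /rpospow t0 -!expRD ler_expR.
set M := `|s| + 1.
have M0 : 0 < M by rewrite /M ltr_wpDl.
have sM : s - 1 <= M.
  by rewrite /M (le_trans (_ : _ <= s)) ?gerBl// (le_trans (ler_norm s))//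
    lerDl.
have l1 : (s - 1) * ln t <= M * ln t by rewrite ler_wpM2r.
have l2 : ln t = ln (2 * M) + ln (t / (2 * M)).
  rewrite -lnM ?posrE ?divr_gt0 ?mulr_gt0//; congr ln; field.
  by rewrite gt_eqF.
have l3 : ln (t / (2 * M)) <= t / (2 * M).
  by apply/ltW/ln_sublinear; rewrite divr_gt0// mulr_gt0.
have l4 : M * ln t <= M * ln (2 * M) + t / 2.
  rewrite l2 mulrDr lerD2l (le_trans (ler_wpM2l (ltW M0) l3))//.
  by rewrite le_eqVlt; apply/orP; left; apply/eqP; field; rewrite gt_eqF.
lra.
Qed.

Lemma integrable_Gamma s : 0 < s ->
  mu.-integrable setT (EFin \o (fun t => rpospow s t * expR (- t))).
Proof.
move=> s0; pose C := expR ((`|s| + 1) * ln (2 * (`|s| + 1))) * 2.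
have h0 : (0 : R) < 2^-1 by rewrite invr_gt0.
have i1 := integrable_exponential_pdf h0.
have i2 := integrableD measurableT (integrable_rpospow01 s0)
  (integrableZl measurableT C i1).
apply: le_integrable i2 => //.
  apply/measurable_EFinP; apply: measurable_funM;
    first exact: measurable_rpospow.
  by apply: measurableT_comp => //; exact: oppr_measurable.
move=> t _ /=; rewrite lee_fin.
have g0 : 0 <= C * exponential_pdf 2^-1 t.
  by rewrite mulr_ge0// ?exponential_pdf_ge0// /C mulr_ge0// expR_ge0.
have p0 : 0 <= (rpospow s \_ `]0, 1]) t.
  by rewrite patchE; case: ifP => // _; exact: rpospow_ge0.
rewrite !ger0_norm ?addr_ge0// ?mulr_ge0 ?rpospow_ge0 ?expR_ge0//.
have [t0|t0] := leP t 0.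
  by rewrite /rpospow ltNge t0 /= mul0r addr_ge0.
have [t1|t1] := leP t 1.
  rewrite patchE mem_set/= ?in_itv/= ?t0//.
  rewrite (le_trans (_ : _ <= rpospow s t))// ?lerDl//.
  by rewrite ler_piMr ?rpospow_ge0// -expR0 ler_expR oppr_le0 ltW.
rewrite (le_trans (rpospow_expN_le _ (ltW t1)))//.
apply: (le_trans _ (lerD p0 (lexx _))); rewrite add0r exponential_pdfE
  ?(ltW t0)//.
by rewrite le_eqVlt; apply/orP; left; apply/eqP; rewrite /C; field.
Qed.

Definition rGamma s : R := \int[mu]_t (rpospow s t * expR (- t)).

Lemma rGamma_gt0 s : 0 < s -> 0 < rGamma s.
Proof.
move=> s0; have i := integrable_Gamma s0.
rewrite -lte_fin /rGamma fineK; last exact: integrable_fin_num.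
(* On [1, 2] the integrand is at least c, since 0 <= ln t <= 1 there. *)
pose c := expR (- `|s - 1| - 2).
apply: (@lt_le_trans _ _ (\int[mu]_(t in `[1%R, 2%R]) c%:E)%E).
  rewrite integral_cst//= lebesgue_measure_itv/= lte_fin ltr1n.
  by rewrite -EFinB -EFinM lte_fin mulr_gt0// ?expR_gt0//; lra.
have m := measurable_int _ i.
apply: (@le_trans _ _ (\int[mu]_(t in `[1%R, 2%R])
  (rpospow s t * expR (- t))%:E)%E).
  apply: ge0_le_integral => //.
  - by move=> t _; rewrite lee_fin expR_ge0.
  - exact: (measurable_funTS m).
  - move=> t; rewrite /= in_itv/= => /andP[t1 t2].
    have t0 : 0 < t by exact: lt_le_trans t1.
    rewrite lee_fin /rpospow t0 -expRD ler_expR lerD ?lerN2//.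
    have l0 := ln_ge0 t1.
    have l1 : ln t <= 1.
      have := @le_ln1Dx R (t - 1); rewrite addrCA subrr addr0 =>
        /(_ _)/le_trans; apply.
        by lra.
      by lra.
    rewrite lerNl -mulNr (le_trans (ler_wpM2r l0 (ler_norm _)))// normrN.
    by rewrite ler_piMr.
apply: ge0_subset_integral => // t _.
by rewrite lee_fin mulr_ge0 ?rpospow_ge0 ?expR_ge0.
Qed.

Lemma Gamma_real s : Gamma s%:C = (rGamma s)%:C.
Proof.
rewrite GammaE; apply: complexP => /=.
  by apply: eq_Rintegral => t _; rewrite cpospow_real cReM /= mulr0 subr0.
rewrite (@eq_Rintegral _ _ R mu _ (fun=> 0)) ?Rintegral_cst// ?mul0r//.
by move=> t _; rewrite cpospow_real cImM /= mulr0 mul0r addr0.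
Qed.

Let cmeasurable_expN :
  cmeasurable ((fun t => (expR (- t))%:C) : measurableTypeR R -> R[i]).
Proof.
by apply: cmeasurable_real; apply: measurableT_comp => //;
  exact: oppr_measurable.
Qed.

Lemma cintegrable_Gamma z : 0 < complex.Re z ->
  cintegrable mu (fun t => cpospow z t * (expR (- t))%:C).
Proof.
move=> z0; apply: cintegrable_dominated (integrable_Gamma z0) _.
  by apply: cmeasurableM; [exact: cmeasurable_cpospow|exact: cmeasurable_expN].
by move=> t; rewrite Normc.normcM normc_cpospow normc_real ger0_norm ?expR_ge0.
Qed.

Lemma Gamma1 : Gamma 1 = 1 :> R[i].
Proof.
rewrite -[1 in LHS]/(1%:C) Gamma_real; congr (_%:C).
transitivity (fine (\int[mu]_t (exponential_pdf (1 : R) t)%:E)%E); last first.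
  by rewrite integral_exponential_pdf.
have i1 := integrable_exponential_pdf (@ltr01 R).
rewrite /rGamma.
have e1 t : rpospow 1 t * expR (- t) = (exponential_pdf 1 \_ `]0, +oo[) t.
  rewrite patchE /rpospow; case: ifPn => t0.
    by rewrite mem_set/= ?in_itv/= ?t0// exponential_pdfE ?(ltW t0)// subrr
      mul0r expR0 mulN1r.
  by rewrite memNset ?mul0r//= in_itv/= (negbTE t0).
rewrite (@eq_Rintegral _ _ R mu _ (exponential_pdf 1 \_ `]0, +oo[));
  last by move=> t _; exact: e1.
rewrite -Rintegral_mkcond Rintegral_itv_obnd_cbnd; last exact: integrableS i1.
by rewrite Rintegral_mkcond; congr fine; apply: eq_integral => t _;
  rewrite /exponential_pdf !patchE; case: ifP => // ->.
Qed.

End GammaBeta.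

(** * Euler's Beta integral *)

Section EulerBeta.
Variable R : realType.
Notation mu := (@lebesgue_measure R).
Notation T := (measurableTypeR R).
Implicit Types (s t : R) (a b z : R[i]).

Let meas_sub : measurable_fun setT (fun p : T * T => p.2 - p.1).
Proof. exact: measurable_funB. Qed.

Let meas_expN2 : measurable_fun setT (fun p : T * T => expR (- p.2)).
Proof.
apply: measurableT_comp => //.
by apply: (@measurableT_comp _ _ _ _ _ _ (fun x : R => - x));
  first exact: oppr_measurable.
Qed.

Lemma measurable_conv s s' : measurable_fun setT
  (fun p : T * T => rpospow s p.1 * rpospow s' (p.2 - p.1) * expR (- p.2)).
Proof.
apply: measurable_funM => //; apply: measurable_funM.
  by apply: measurableT_comp => //; exact: measurable_rpospow.
by apply: measurableT_comp => //; exact: measurable_rpospow.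
Qed.

Lemma cmeasurable_conv a b : cmeasurable
  (fun p : T * T => cpospow a p.1 * cpospow b (p.2 - p.1) * (expR (- p.2))%:C).
Proof.
apply: cmeasurableM; last exact: cmeasurable_real.
apply: cmeasurableM.
  by apply: (cmeasurable_comp (@cmeasurable_cpospow R a)).
exact: (cmeasurable_comp (@cmeasurable_cpospow R b)).
Qed.

Let conv_ge0 s s' t w : 0 <= rpospow s t * rpospow s' (w - t) * expR (- w).
Proof. by rewrite !mulr_ge0 ?rpospow_ge0 ?expR_ge0. Qed.

(** Integrating first in [w] separates the variables, by translation. *)
Lemma integral_conv_slice s s' t : 0 < s' ->
  (\int[mu]_w (rpospow s t * rpospow s' (w - t) * expR (- w))%:E =
   (rpospow s t * expR (- t))%:E * (rGamma s')%:E)%E.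
Proof.
move=> s'0; have i := integrable_Gamma s'0.
have m := measurable_int _ i.
have g0 w : (0 <= (rpospow s' w * expR (- w))%:E)%E.
  by rewrite lee_fin mulr_ge0 ?rpospow_ge0 ?expR_ge0.
rewrite /rGamma fineK; last exact: integrable_fin_num.
rewrite (ge0_integral_affine (- t) ltr01 m g0) mul1e.
rewrite -ge0_integralZl//.
- apply: eq_integral => w _ /=; rewrite -EFinM mul1r; congr EFin.
  have -> : expR (- w) = expR (- t) * expR (- (w - t)).
    by rewrite -expRD; congr expR; ring.
  ring.
- by apply: (measurableT_comp m); apply: measurable_funD => //;
    exact: measurable_funM.
- by move=> w _; exact: g0.
- by rewrite lee_fin mulr_ge0 ?rpospow_ge0 ?expR_ge0.
Qed.

Lemma integrable_conv s s' : 0 < s -> 0 < s' ->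
  (mu \x mu)%E.-integrable setT
    (fun p : T * T =>
      (rpospow s p.1 * rpospow s' (p.2 - p.1) * expR (- p.2))%:E).
Proof.
move=> s0 s'0; apply/integrable12ltyP.
  by apply/measurable_EFinP; exact: measurable_conv.
rewrite (@eq_integral _ _ _ _ _ (fun t : T =>
  (rpospow s t * expR (- t))%:E * (rGamma s')%:E)%E); last first.
  move=> t _; rewrite -integral_conv_slice//; apply: eq_integral => w _ /=.
  by rewrite ger0_norm// conv_ge0.
have i := integrable_Gamma s0; have m := measurable_int _ i.
rewrite ge0_integralZr//; last 2 first.
- by move=> t _; rewrite lee_fin mulr_ge0 ?rpospow_ge0 ?expR_ge0.
- by rewrite lee_fin ltW// rGamma_gt0.
have := integrable_fin_num measurableT i.
by case: (\int[mu]_x _)%E => // r _; rewrite -EFinM ltry.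
Qed.

(** Integrating the same double integral first in [t] gives, by scaling, the
    product of the Gamma integral at s + s' with the Beta integral.  The total
    is finite and Gamma(s + s') is positive, hence the Beta integral is
    finite. *)
Lemma integrable_beta s s' : 0 < s -> 0 < s' ->
  mu.-integrable setT (EFin \o (fun u => rpospow s u * rpospow s' (1 - u))).
Proof.
move=> s0 s'0.
have mb : measurable_fun setT (EFin \o (fun u : T =>
  rpospow s u * rpospow s' (1 - u))).
  apply/measurable_EFinP; apply: measurable_funM;
    first exact: measurable_rpospow.
  apply: (measurableT_comp (@measurable_rpospow R s')); exact: measurable_funB.
have b0 (u : R) : (0 <= (rpospow s u * rpospow s' (1 - u))%:E)%E.
  by rewrite lee_fin mulr_ge0 ?rpospow_ge0.
apply/integrableP; split => //.
rewrite (@eq_integral _ _ _ _ _ (fun u : T =>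
  (rpospow s u * rpospow s' (1 - u))%:E)); last first.
  by move=> u _ /=; rewrite ger0_norm// mulr_ge0 ?rpospow_ge0.
set B := (\int[mu]_x _)%E.
have B0 : (0 <= B)%E by apply: integral_ge0 => u _; exact: b0.
have ss' := addr_gt0 s0 s'0.
have i := integrable_Gamma ss'; have m := measurable_int _ i.
have slice w : (\int[mu]_t (rpospow s t * rpospow s' (w - t) * expR (- w))%:E =
    (rpospow (s + s') w * expR (- w))%:E * B)%E.
  have [w0|w0] := leP w 0.
    rewrite [rpospow (s + s') w]/rpospow ltNge w0/= mul0r mul0e integral0_eq//
      => t _.
    rewrite /rpospow; case: ifPn => t0; last by rewrite !mul0r.
    by rewrite subr_gt0 ltNge (le_trans w0 (ltW t0)) /= mulr0 mul0r.
  rewrite (@ge0_integral_affine _ w 0 w0); last 2 first.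
  - apply/measurable_EFinP; apply: measurable_funM => //.
    apply: measurable_funM; first exact: measurable_rpospow.
    apply: (measurableT_comp (@measurable_rpospow R s'));
      exact: measurable_funB.
  - by move=> t; rewrite lee_fin conv_ge0.
  rewrite -ge0_integralZl//; last 3 first.
  - apply/measurable_EFinP; apply: measurable_funM => //.
    apply: measurable_funM.
      apply: (measurableT_comp (@measurable_rpospow R s)).
      by apply: measurable_funD => //; exact: measurable_funM.
    apply: (measurableT_comp (@measurable_rpospow R s'));
      apply: measurable_funB => //.
    by apply: measurable_funD => //; exact: measurable_funM.
  - by move=> t _; rewrite lee_fin conv_ge0.
  - by rewrite lee_fin ltW.
  rewrite -(ge0_integralZl mu measurableT mb)//; last 2 first.
  - by move=> u _; exact: b0.
  - by rewrite lee_fin mulr_ge0 ?rpospow_ge0 ?expR_ge0.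
  apply: eq_integral => u _ /=; rewrite -!EFinM addr0; congr EFin.
  rewrite -[X in rpospow s' (X - _)]mulr1 -mulrBr !rpospow_scale//
    [rpospow (s + s') w]/rpospow w0.
  rewrite -{1}(lnK w0) (_ : (s + s' - 1) * ln w = ln w +
    ((s - 1) * ln w + (s' - 1) * ln w)).
    by rewrite !expRD; ring.
  by ring.
have ic := integrable_conv s0 s'0.
have /= := (integrable21ltyP _ _ (measurable_int _ ic)).1 ic.
rewrite (@eq_integral _ _ _ _ _ (fun w : T =>
  (rpospow (s + s') w * expR (- w))%:E * B)%E); last first.
  move=> w _; rewrite -slice; apply: eq_integral => t _ /=.
  by rewrite ger0_norm// conv_ge0.
rewrite ge0_integralZr//; last first.
  by move=> t _; rewrite lee_fin mulr_ge0 ?rpospow_ge0 ?expR_ge0.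
have -> : (\int[mu]_x (rpospow (s + s') x * expR (- x))%:E =
  (rGamma (s + s'))%:E)%E.
  by rewrite /rGamma fineK//; exact: integrable_fin_num.
case: B B0 {slice} => // [r _ _|_]; first by rewrite ltry.
by rewrite gt0_muley ?lte_fin ?rGamma_gt0// ltxx.
Qed.

Definition Beta a b : R[i] :=
  cint mu (fun u => cpospow a u * cpospow b (1 - u)).

Lemma cmeasurable_beta a b :
  cmeasurable (fun u : T => cpospow a u * cpospow b (1 - u)).
Proof.
apply: cmeasurableM; first exact: cmeasurable_cpospow.
apply: (cmeasurable_comp (@cmeasurable_cpospow R b)); exact: measurable_funB.
Qed.

Lemma cintegrable_beta a b : 0 < complex.Re a -> 0 < complex.Re b ->
  cintegrable mu (fun u => cpospow a u * cpospow b (1 - u)).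
Proof.
move=> a0 b0; apply: cintegrable_dominated (integrable_beta a0 b0) _.
  exact: cmeasurable_beta.
by move=> t; rewrite Normc.normcM !normc_cpospow.
Qed.

(** Both sides are the integral of a(t) b(w - t) exp(-w) over the plane, where
    a and b are the two powers, integrated in the two possible orders. *)
Lemma GammaM_Beta a b : 0 < complex.Re a -> 0 < complex.Re b ->
  Gamma a * Gamma b = Beta a b * Gamma (a + b).
Proof.
move=> a0 b0.
have ab0 : 0 < complex.Re (a + b) by rewrite cReD addr_gt0.
have ib := cintegrable_beta a0 b0.
have ia := cintegrable_Gamma a0; have ig := cintegrable_Gamma b0.
have iab := cintegrable_Gamma ab0.
have ic : cintegrable (mu \x mu)%E
    (fun p : T * T => cpospow a p.1 * cpospow b (p.2 - p.1) *
      (expR (- p.2))%:C).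
  apply: cintegrable_dominated (integrable_conv a0 b0) _.
    exact: cmeasurable_conv.
  by move=> p; rewrite !Normc.normcM !normc_cpospow normc_real ger0_norm
    ?expR_ge0.
have := cFubini ic => /=.
have -> : cint mu (fun t => cint mu (fun w =>
  cpospow a t * cpospow b (w - t) * (expR (- w))%:C)) =
    Gamma a * Gamma b.
  rewrite [in RHS]GammaE [RHS]mulrC -cintZ//; apply: eq_cint => t.
  rewrite GammaE (cint_affine (- t) ltr01 ig) mul1r mulrC -cintZ; last first.
    exact: (cintegrable_affine (- t) ltr01 ig).
  apply: eq_cint => w; rewrite mul1r.
  have -> : expR (- w) = expR (- t) * expR (- (w - t)).
    by rewrite -expRD; congr expR; ring.
  by rewrite rmorphM/=; ring.
move=> ->.
rewrite [Gamma (a + b)]GammaE -cintZ//; apply: eq_cint => w.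
have [w0|w0] := leP w 0.
  rewrite [cpospow (a + b) w]/cpospow ltNge w0/= mul0r mulr0.
  rewrite (_ : (fun _ => _) = fun=> 0 * 0).
    by rewrite cintZ ?mul0r//; split; exact: integrable0.
  apply/funext => t; rewrite mul0r /cpospow; case: ifPn => t0;
    last by rewrite !mul0r.
  by rewrite subr_gt0 ltNge (le_trans w0 (ltW t0)) /= mulr0 mul0r.
have wV0 : 0 < w^-1 by rewrite invr_gt0.
rewrite /Beta (cint_affine 0 wV0 ib) mulrC mulrA -cintZ; last first.
  exact: (cintegrable_affine 0 wV0 ib).
apply: eq_cint => t; rewrite addr0.
have wt : t = w * (w^-1 * t) by rewrite mulrA divff ?mul1r// gt_eqF.
rewrite {1 2}wt -[X in cpospow b (X - _)]mulr1 -mulrBr !(cpospow_scale _ _ w0)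
  [cpospow (a + b) w]/cpospow w0.
rewrite (_ : (a + b - 1) * (ln w)%:C = (ln w)%:C +
  ((a - 1) * (ln w)%:C + (b - 1) * (ln w)%:C)).
  rewrite !cexpD cexp_real lnK//.
  have wC : w%:C * (w^-1)%:C = 1 by rewrite -rmorphM/= divff// gt_eqF.
  transitivity (w%:C * (w^-1)%:C * (cexp ((a - 1) * (ln w)%:C) * cpospow a
    (w^-1 * t) *
   (cexp ((b - 1) * (ln w)%:C) * cpospow b (1 - w^-1 * t)) * (expR (- w))%:C)).
    by rewrite wC mul1r.
  by ring.
by ring.
Qed.

(** The Beta formula at (z, 1), since Gamma(1) = 1. *)
Lemma Gamma_add1 z : 0 < complex.Re z -> Gamma (z + 1) = z * Gamma z.
Proof.
move=> z0; have := GammaM_Beta z0 (ltr01 : 0 < complex.Re (1 : R[i])).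
by rewrite Gamma1 mulr1 => ->; rewrite mulrA cint_power01// mul1r.
Qed.

End EulerBeta.

(** * Gamma has no zero of positive real part *)

Section GammaNonzero.
Variable R : realType.
Notation mu := (@lebesgue_measure R).
Implicit Types (s t : R) (z : R[i]).

Lemma sin_sqr_le (x : R) : sin x ^+ 2 <= x ^+ 2.
Proof.
wlog x0 : x / 0 < x.
  move=> H; have [x0|x0|->] := ltgtP x 0; last by rewrite sin0.
    by have := H (- x); rewrite sinN !sqrrN oppr_gt0; exact.
  exact: H.
have [c _] := @MVT R sin cos 0 x x0 (fun y _ => is_derive_sin y)
  (continuous_subspaceT (@continuous_sin R)).
by rewrite sin0 !subr0 => ->; rewrite exprMn ler_piMl ?sqr_ge0.
Qed.

Lemma cos_ge_quadratic (x : R) : 1 - x ^+ 2 / 2 <= cos x.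
Proof.
have -> : x = (x / 2) *+ 2 by rewrite -mulr_natr; field.
rewrite cos_mulr2n -[cos _ ^+ 2](addrK (sin (x / 2) ^+ 2)) cos2Dsin2.
by have := sin_sqr_le (x / 2); lra.
Qed.

(** With u = exp(2x) this is |x| <= |exp(x) - exp(-x)|.  The right-hand side is
    chosen because multiplying it into the Gamma integrand only shifts the
    argument of Gamma by an integer. *)
Lemma ln_sqr_le (u : R) : 0 < u -> ln u ^+ 2 <= 4 * (u - 2 + u^-1).
Proof.
move=> u0; pose x := ln u / 2; pose w := expR x.
have w0 : 0 < w by exact: expR_gt0.
have uw : u = w ^+ 2.
  have xx : x + x = ln u by rewrite /x; field.
  by rewrite /w expr2 -expRD xx lnK.
have xE : ln u = 2 * x by rewrite /x; field.
have w1 : 1 + x <= w by exact: expR_ge1Dx.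
have w2 : 1 - x <= w^-1 by rewrite /w -expRN expR_ge1Dx.
have v0 : 0 < w^-1 by rewrite invr_gt0.
rewrite [leRHS](_ : _ = 4 * (w - w^-1) ^+ 2); last first.
  by rewrite uw; field; rewrite gt_eqF.
rewrite xE exprMn (_ : 2 ^+ 2 = 4 :> R) ?ler_pM2l//; last by rewrite -natrX.
have [x0|x0] := leP 0 x.
  have vle : w^-1 <= 1 by rewrite invf_le1//; lra.
  by rewrite ler_sqr ?nnegrE//; lra.
have wle : w <= 1 by rewrite -[leRHS]expR0 ler_expR ltW.
by rewrite -[x ^+ 2]sqrrN -[(_ - _) ^+ 2]sqrrN ler_sqr ?nnegrE//; lra.
Qed.

Lemma rGamma_add1 s : 0 < s -> rGamma (s + 1) = s * rGamma s.
Proof.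
move=> s0; have := @Gamma_add1 R s%:C s0.
rewrite -[X in Gamma (_ + X)]/(1%:C) -rmorphD !Gamma_real -rmorphM.
exact: (@complexI R).
Qed.

(** Write z = s + iy.  The real part of s^(-iy) Gamma(z) is the integral of
    t^(s-1) exp(-t) cos(y ln(t/s)); bounding the cosine from below by
    1 - 2 y^2 (t/s - 2 + s/t) and integrating gives at least
    Gamma(s) (1 - 2 y^2 / (s-1)), which is positive. *)
Lemma Gamma_neq0_far z : 1 + 2 * complex.Im z ^+ 2 < complex.Re z ->
  Gamma z != 0.
Proof.
case: z => s y /= sy; have y2 : 0 <= y ^+ 2 by exact: sqr_ge0.
have s1 : 0 < s - 1 by lra.
have s0 : 0 < s by lra.
have i0 := integrable_Gamma s1.
have i1 := integrable_Gamma s0.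
have i2 := integrable_Gamma (addr_gt0 s0 ltr01).
have := @cintegrable_Gamma R (s +i* y) s0.
set f := fun t => _ => icf.
pose c := cexp (- (y *i) * (ln s)%:C).
(* g is t^(s-1) exp(-t) (1 - 2 y^2 (t/s - 2 + s/t)), expanded. *)
pose g t : R := (1 + 4 * y ^+ 2) * (rpospow s t * expR (- t)) +
  ((- 2 * y ^+ 2 / s) * (rpospow (s + 1) t * expR (- t)) +
   (- 2 * y ^+ 2 * s) * (rpospow (s - 1) t * expR (- t))).
have iZ (r : R) (h : R -> R) : mu.-integrable setT (EFin \o h) ->
    mu.-integrable setT (EFin \o (fun t => r * h t)).
  by move=> ih; have := integrableZl measurableT r ih.
have iD (h h' : R -> R) : mu.-integrable setT (EFin \o h) ->
    mu.-integrable setT (EFin \o h') ->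
    mu.-integrable setT (EFin \o (fun t => h t + h' t)).
  by move=> ih ih'; have := integrableD measurableT ih ih'.
have ig : mu.-integrable setT (EFin \o g).
  by apply: (iD); [exact: iZ|apply: (iD); exact: iZ].
have gE : \int[mu]_t g t = (1 - 2 * y ^+ 2 / (s - 1)) * rGamma s.
  rewrite /g RintegralD//; [|exact: iZ|apply: (iD); exact: iZ].
  rewrite RintegralD//; [|exact: iZ|exact: iZ].
  rewrite !RintegralZl// -!/(rGamma _) rGamma_add1//.
  rewrite (_ : rGamma s = (s - 1) * rGamma (s - 1)); last first.
    by rewrite -(rGamma_add1 s1) subrK.
  by field; rewrite !gt_eqF.
have gf t : g t <= complex.Re (c * f t).
  rewrite /g /f /cpospow {1 2 3}/rpospow; have [t0|t0] := ltP 0 t; last first.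
    by rewrite !mul0r !mulr0 !addr0.
  have e1 : expR ((s + 1 - 1) * ln t) = t * expR ((s - 1) * ln t).
    by rewrite -{2}(lnK t0) -expRD; congr expR; ring.
  have e2 : expR ((s - 1 - 1) * ln t) = t^-1 * expR ((s - 1) * ln t).
    by rewrite -{2}(lnK t0) -expRN -expRD; congr expR; ring.
  have ce : - (y *i) * (ln s)%:C + (s +i* y - 1) * (ln t)%:C =
      ((s - 1) * ln t) +i* (y * (ln t - ln s)).
    by apply: complexP; rewrite /=; ring.
  rewrite e1 e2 [c * _]mulrA /c -cexpD ce [_ * _%:C in leRHS]mulrC cRe_realM
    Re_cexp /=.
  set P := expR _; have P0 : 0 <= P by exact: expR_ge0.
  set E := expR _; have E0 : 0 <= E by exact: expR_ge0.
  have st0 : 0 < t / s by rewrite divr_gt0.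
  have := ln_sqr_le st0; rewrite ln_div// invf_div => lnle.
  have := cos_ge_quadratic (y * (ln t - ln s)).
  rewrite exprMn => cosle.
  have key : 1 - 2 * y ^+ 2 * (t / s - 2 + s / t) <= cos (y * (ln t - ln s)).
    by have := ler_wpM2l y2 lnle; lra.
  have := ler_wpM2l (mulr_ge0 E0 P0) key.
  move=> H; rewrite [leRHS]mulrA; apply: (le_trans _ H).
  by rewrite le_eqVlt; apply/orP; left; apply/eqP; field; rewrite !gt_eqF.
apply/negP => /eqP z0.
have : complex.Re (c * Gamma (s +i* y)) = 0 by rewrite z0 mulr0.
rewrite GammaE -cintZ//= => e.
have : \int[mu]_t g t <= 0.
  rewrite -e; apply: le_Rintegral => //.
  exact: (cintegrableM c icf).1.
rewrite gE leNgt mulr_gt0 ?rGamma_gt0// subr_gt0 ltr_pdivrMr// mul1r; lra.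
Qed.

Lemma Gamma_neq0 z : 0 < complex.Re z -> Gamma z != 0.
Proof.
move=> z0.
have shift n : Gamma z = 0 -> Gamma (z + n%:R) = 0.
  move=> e; elim: n => [|n IH]; first by rewrite addr0.
  rewrite -natr1 addrA Gamma_add1 ?IH ?mulr0//.
  by rewrite cReD Re_nat ltr_wpDr.
apply/negP => /eqP e; pose n := (Num.truncn (1 + 2 * complex.Im z ^+ 2)).+1.
suff : Gamma (z + n%:R) != 0 by rewrite shift// eqxx.
apply: Gamma_neq0_far; rewrite cImD Im_nat addr0 cReD Re_nat.
by apply: (lt_le_trans (truncnS_gt _)); rewrite lerDr ltW.
Qed.

End GammaNonzero.

(** * Taylor expansion of the complex exponential *)

Lemma is_derive_monomial (R : realType) (d t : R) n :
  is_derive t 1 (fun u : R => u ^+ n.+1 * d) (n.+1%:R * t ^+ n * d).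
Proof.
have dX : is_derive t 1 (fun u : R => u ^+ n.+1) (n.+1%:R * t ^+ n).
  split; first exact: exprn_derivable.
  by rewrite exp_derive /= /GRing.scale/= mulr1.
rewrite (_ : (fun _ => _) = d *: (fun u : R => u ^+ n.+1)).
  by apply: (is_derive_eq (is_deriveZ d dX)); rewrite /GRing.scale/= mulrC.
by apply/funext => u; rewrite mulrC.
Qed.

Section Taylor.
Variable R : realType.
Variable z : R[i].
Implicit Types (t : R).

Definition expsum n (w : R[i]) : R[i] := \sum_(0 <= k < n) w ^+ k / k`!%:R.

Let cderive (f : R -> R[i]) t (d : R[i]) :=
  is_derive t 1 (fun t => complex.Re (f t)) (complex.Re d) /\
  is_derive t 1 (fun t => complex.Im (f t)) (complex.Im d).

Let cderive_cexp t :
  cderive (fun t => cexp (t%:C * z)) t (z * cexp (t%:C * z)).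
Proof.
have E (p : R) : is_derive t 1 (fun t =>
  expR (t * complex.Re z) * cos (t * complex.Im z + p))
   (expR (t * complex.Re z) * (complex.Re z * cos (t * complex.Im z + p) -
      complex.Im z * sin (t * complex.Im z + p))).
  by apply: is_derive_eq; rewrite /GRing.scale/=; ring.
have sinE (u : R) : sin u = cos (u - pi / 2).
  by rewrite cosB cos_pihalf sin_pihalf mulr0 mulr1 add0r.
have cosE (u : R) : - cos u = sin (u - pi / 2).
  by rewrite sinB cos_pihalf sin_pihalf mulr0 mulr1 sub0r.
split.
  rewrite (_ : (fun _ => _) = fun t => expR (t * complex.Re z) * cos
    (t * complex.Im z + 0)).
    apply: (is_derive_eq (E 0)).
    by rewrite [RHS]cReM Re_cexp Im_cexp cRe_realM cIm_realM addr0; ring.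
  by apply/funext => u; rewrite Re_cexp cRe_realM cIm_realM addr0.
rewrite (_ : (fun _ => _) = fun t => expR (t * complex.Re z) * cos
  (t * complex.Im z + - (pi / 2))).
  apply: (is_derive_eq (E _)).
  by rewrite [RHS]cImM Re_cexp Im_cexp cRe_realM cIm_realM -sinE -cosE; ring.
by apply/funext => u; rewrite Im_cexp cRe_realM cIm_realM sinE.
Qed.

Let cderive_sum n t :
  cderive (fun t => expsum n.+1 (t%:C * z)) t (z * expsum n (t%:C * z)).
Proof.
elim: n => [|n [IH1 IH2]].
  rewrite /expsum big_nil mulr0; split;
    under eq_fun do rewrite big_nat1 expr0 fact0 divr1; exact: is_derive_cst.
have EC m (u : R) : (u%:C * z) ^+ m / m`!%:R = (u ^+ m)%:C * (z ^+ m / m`!%:R).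
  by rewrite exprMn rmorphXn/= mulrA.
have key (c d : R) : c = n.+1%:R * d ->
    is_derive t 1 (fun u : R => u ^+ n.+1 * d) (t ^+ n * c).
  by move=> ->; apply: (is_derive_eq (is_derive_monomial d t n)); ring.
have zE : z * (z ^+ n / n`!%:R) = n.+1%:R%:C * (z ^+ n.+1 / n.+1`!%:R).
  have s0 : n.+1%:R != 0 :> R[i] by rewrite pnatr_eq0.
  have f0 : n`!%:R != 0 :> R[i] by rewrite pnatr_eq0 -lt0n fact_gt0.
  rewrite real_complex_nat factS natrM exprS;
    move: (n.+1%:R : R[i]) (n`!%:R : R[i]) s0 f0 => p f s0 f0.
  by field; rewrite f0 s0.
split; under eq_fun do rewrite /expsum big_nat_recr//= ?cReD ?cImD EC ?cRe_realM
  ?cIm_realM.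
  apply: (is_derive_eq (is_deriveD IH1 (key (complex.Re (z * (z ^+ n / n`!%:R)))
    _ _))).
    by rewrite zE cRe_realM.
  by rewrite /expsum [in RHS]big_nat_recr//= [in RHS]mulrDr cReD EC
    [in RHS]mulrCA cRe_realM.
apply: (is_derive_eq (is_deriveD IH2 (key (complex.Im (z * (z ^+ n / n`!%:R))) _
  _))).
  by rewrite zE cIm_realM.
by rewrite /expsum [in RHS]big_nat_recr//= [in RHS]mulrDr cImD EC [in RHS]mulrCA
  cIm_realM.
Qed.

Let rem n t := cexp (t%:C * z) - expsum n (t%:C * z).

Let cderive_rem n t : cderive (rem n.+1) t (z * rem n t).
Proof.
have [e1 e2] := cderive_cexp t; have [s1 s2] := cderive_sum n t.
rewrite /cderive /rem mulrBr cReB cImB; split.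
  by under eq_fun do rewrite cReB; exact: is_deriveB.
by under eq_fun do rewrite cImB; exact: is_deriveB.
Qed.

Let rem0 n : rem n.+1 0 = 0.
Proof.
rewrite /rem mul0r cexp0 /expsum big_nat_recl//= expr0 fact0 divr1 big1 ?addr0
  ?subrr//.
by move=> i _; rewrite expr0n /= mul0r.
Qed.

Let ge0_from_derive (f f' : R -> R) t :
  (forall u : R, is_derive u (1 : R) f (f' u)) ->
  f 0 = 0 -> 0 <= t -> (forall u, 0 <= u <= t -> 0 <= f' u) -> 0 <= f t.
Proof.
move=> df f0 t0 f'0.
have [c cin] := @MVT_segment R f f' 0 t t0 (fun u _ => df u)
  (@derivable_within_continuous _ _ _ _ (fun u _ =>
    @ex_derive _ _ _ _ _ _ _ (df u))).
by rewrite f0 !subr0 => ->; rewrite mulr_ge0// f'0.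
Qed.

(** Each remainder vanishes at 0 and has z times the previous one as
    derivative.  The bound K (M t)^n / n!, with K = exp |Re z| and
    M = |Re z| + |Im z|, is reproduced by integration, because M bounds the
    effect of multiplication by z on each of the two components. *)
Lemma Taylor_cexp n t : 0 <= t <= 1 ->
  Normc.normc (cexp (t%:C * z) - expsum n (t%:C * z)) <=
  2 * expR `|complex.Re z| * exp_coeff (`|complex.Re z| + `|complex.Im z|) n.
Proof.
rewrite -/(rem n t); set x := complex.Re z; set y := complex.Im z;
  set M := `|x| + `|y|.
have M0 : 0 <= M by rewrite addr_ge0.
set K := expR `|x|; have K0 : 0 <= K by exact: expR_ge0.
have main : 0 <= t <= 1 ->
    `|complex.Re (rem n t)| <= K * ((M * t) ^+ n / n`!%:R) /\
    `|complex.Im (rem n t)| <= K * ((M * t) ^+ n / n`!%:R).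
  elim: n t => [|n IH] t /andP[t0 t1].
    rewrite expr0 fact0 divr1 mulr1 /rem /expsum big_nil subr0 Re_cexp Im_cexp
      cRe_realM cIm_realM.
    have e : expR (t * x) <= K.
      rewrite ler_expR (le_trans (ler_norm _))// normrM (ger0_norm t0).
      by rewrite ler_piMl.
    by rewrite !normrM ger0_norm ?expR_ge0//; split;
      rewrite (le_trans _ e)// ler_piMr ?expR_ge0// ?cos_max ?sin_max.
  have dG (u : R) : is_derive u (1 : R) (fun u =>
    K * ((M * u) ^+ n.+1 / n.+1`!%:R))
      (M * (K * ((M * u) ^+ n / n`!%:R))).
    rewrite (_ : (fun _ => _) = fun u =>
      u ^+ n.+1 * (K * M ^+ n.+1 / n.+1`!%:R)).
      apply: (is_derive_eq (is_derive_monomial _ u n)).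
      have s0 : n.+1%:R != 0 :> R by rewrite pnatr_eq0.
      have f0 : n`!%:R != 0 :> R by rewrite pnatr_eq0 -lt0n fact_gt0.
      rewrite exprMn exprS factS natrM; move: (n.+1%:R : R) (n`!%:R : R) s0 f0
        => p f s0 f0.
      by field; rewrite f0 s0.
    by apply/funext => v; rewrite exprMn; ring.
  have bnd (C A B v w : R) : `|A| <= C -> `|B| <= C -> `|v| + `|w| = M ->
      `|v * A + w * B| <= M * C.
    move=> hA hB vw; rewrite (le_trans (ler_normD _ _))// !normrM -vw mulrDl.
    by rewrite lerD// ler_wpM2l.
  have G0 : K * ((M * 0) ^+ n.+1 / n.+1`!%:R) = 0 by rewrite mulr0 expr0n mul0r
    mulr0.
  have conc (A A' : R -> R) : (forall u : R, is_derive u (1 : R) A (A' u)) ->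
    A 0 = 0 ->
      (forall u, 0 <= u <= t -> `|A' u| <= M * (K * ((M * u) ^+ n / n`!%:R))) ->
      `|A t| <= K * ((M * t) ^+ n.+1 / n.+1`!%:R).
    move=> dA A0 hA; rewrite ler_norml -subr_ge0 opprK; apply/andP; split.
      rewrite addrC.
      apply: (@ge0_from_derive (fun u => K * ((M * u) ^+ n.+1 / n.+1`!%:R) + A
        u) _ t
        (fun u => is_deriveD (dG u) (dA u))) => //.
        by rewrite G0 A0 addr0.
      by move=> u /hA; rewrite ler_norml -subr_ge0 opprK addrC => /andP[].
    rewrite -subr_ge0.
    apply: (@ge0_from_derive (fun u => K * ((M * u) ^+ n.+1 / n.+1`!%:R) - A u)
      _ t
      (fun u => is_deriveB (dG u) (dA u))) => //.
      by rewrite G0 A0 subr0.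
    by move=> u /hA; rewrite ler_norml subr_ge0 => /andP[].
  split.
    apply: (conc (fun u => complex.Re (rem n.+1 u)) (fun u =>
      complex.Re (z * rem n u))).
    - by move=> u; have [] := cderive_rem n u.
    - by rewrite rem0.
    - move=> u /andP[u0 ut]; have [] := IH u; first by rewrite u0 (le_trans ut).
      move=> h1 h2; rewrite cReM -mulNr; apply: bnd => //.
      by rewrite normrN.
  apply: (conc (fun u => complex.Im (rem n.+1 u)) (fun u =>
    complex.Im (z * rem n u))).
  - by move=> u; have [] := cderive_rem n u.
  - by rewrite rem0.
  - move=> u /andP[u0 ut]; have [] := IH u; first by rewrite u0 (le_trans ut).
    move=> h1 h2; rewrite cImM; apply: bnd => //.
move=> /[dup] /andP[t0 t1] /main[h1 h2].
rewrite (le_trans (normc_le_ReIm _))// (le_trans (lerD h1 h2))//.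
rewrite -mulrA -[leLHS]mulr2n -[leLHS]mulr_natl ler_wpM2l// ler_wpM2l//
  /exp_coeff /=.
rewrite ler_wpM2r ?invr_ge0// ?ler0n//.
by rewrite lerXn2r ?nnegrE ?mulr_ge0// ler_piMr.
Qed.

End Taylor.

(** * Kummer's integral for 1F1 *)

Section Kummer.
Variable R : realType.
Notation mu := (@lebesgue_measure R).
Implicit Types (a b y z : R[i]).

Lemma Gamma_pochhammer z n : 0 < complex.Re z ->
  Gamma (z + n%:R) = pochhammer z n * Gamma z.
Proof.
move=> z0; elim: n => [|n IH]; first by rewrite /pochhammer big_ord0 mul1r
  addr0.
rewrite -natr1 addrA Gamma_add1; last by rewrite cReD Re_nat ltr_wpDr.
by rewrite IH /pochhammer big_ord_recr/=; ring.
Qed.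

Lemma pochhammer_neq0 z n : 0 < complex.Re z -> pochhammer z n != 0.
Proof.
move=> z0; apply: contra_neq (@Gamma_neq0 R (z + n%:R) _) => [e|].
  by rewrite Gamma_pochhammer// e mul0r.
by rewrite cReD Re_nat ltr_wpDr.
Qed.

Lemma Beta_Gamma a b : 0 < complex.Re a -> 0 < complex.Re b ->
  Beta a b = Gamma a * Gamma b / Gamma (a + b).
Proof.
move=> a0 b0; rewrite GammaM_Beta// mulfK// Gamma_neq0//.
by rewrite cReD addr_gt0.
Qed.

Lemma Beta_shift a b n : 0 < complex.Re a -> 0 < complex.Re b ->
  Beta b (a + n%:R) = pochhammer a n / pochhammer (a + b) n * Beta b a.
Proof.
move=> a0 b0; have ab0 : 0 < complex.Re (a + b) by rewrite cReD addr_gt0.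
rewrite !Beta_Gamma//; last by rewrite cReD Re_nat ltr_wpDr.
rewrite addrA [b + a]addrC !Gamma_pochhammer//.
have := Gamma_neq0 ab0; have := pochhammer_neq0 n ab0.
move: (pochhammer (a + b) n) (Gamma (a + b)) => p g p0 g0.
by field; rewrite p0 g0.
Qed.

Lemma cpospow_shift z n (t : R) :
  t%:C ^+ n * cpospow z t = cpospow (z + n%:R) t.
Proof.
elim: n => [|n IH]; first by rewrite expr0 mul1r addr0.
by rewrite exprS -mulrA IH mulr_cpospow -natr1 addrA.
Qed.

(** The complex numbers carry a norm with values in themselves; this reduces
    convergence for it to a real majorant. *)
Lemma cvg_complex (u : nat -> R[i]) (l : R[i]) (d : nat -> R) :
  d @ \oo --> 0 -> (forall n, Normc.normc (l - u n) <= d n) ->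
  (u : nat -> R[i]^o) @ \oo --> (l : R[i]^o).
Proof.
move=> d0 ud; apply/(@cvgrPdist_lt _ (R[i]^o)) => eps eps0.
have [r r0 ->] : exists2 r : R, 0 < r & eps = r%:C.
  exists (complex.Re eps); first by move: eps0; rewrite ltcE => /andP[].
  by apply: complexP => //=; move: eps0; rewrite ltcE => /andP[/eqP].
move/cvgr0Pnorm_lt : d0 => /(_ r r0); apply: filterS => n dn.
rewrite -[X in X < _]/(`|l - u n : R[i]|) normc_def ltcR.
apply: le_lt_trans dn; rewrite (le_trans _ (ler_norm _))//
  (le_trans _ (ud n))//.
by case: (l - u n).
Qed.

Lemma beta_eq0 a b (u : R) : ~~ ((0 < u) && (u < 1)) ->
  rpospow (complex.Re b) u * rpospow (complex.Re a) (1 - u) = 0.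
Proof.
by rewrite negb_and /rpospow subr_gt0 => /orP[|] /negbTE ->;
  rewrite ?mul0r ?mulr0.
Qed.

Lemma cintegrable_beta_exp a b y : 0 < complex.Re a -> 0 < complex.Re b ->
  cintegrable mu (fun u =>
    cpospow b u * cpospow a (1 - u) * cexp ((1 - u)%:C * y)).
Proof.
move=> a0 b0; pose F u := cpospow b u * cpospow a (1 - u).
pose f u := rpospow (complex.Re b) u * rpospow (complex.Re a) (1 - u).
have i_f : mu.-integrable setT (EFin \o f) by exact: integrable_beta.
have mexp : cmeasurable (fun u : measurableTypeR R => cexp ((1 - u)%:C * y)).
  apply: cmeasurable_cexp; apply: cmeasurableM; last exact: cmeasurable_cst.
  by apply: cmeasurable_real; exact: measurable_funB.
apply: (@cintegrable_dominated _ (measurableTypeR R) R mu _ (fun u =>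
  expR `|complex.Re y| * f u)).
- by apply: cmeasurableM => //; exact: cmeasurable_beta.
- by have := integrableZl measurableT (expR `|complex.Re y|) i_f.
- move=> u; have fF : f u = Normc.normc (F u) by rewrite Normc.normcM
    !normc_cpospow.
  rewrite Normc.normcM -fF mulrC; have [u01|u01] := boolP ((0 < u) && (u < 1)).
    rewrite ler_wpM2r ?fF ?normc_ge0// normc_cexp cRe_realM ler_expR.
    rewrite (le_trans (ler_norm _))// normrM ger0_norm ?ler_piMl//;
      by move: u01 => /andP[u0 u1]; lra.
  by rewrite [f u]beta_eq0// !mulr0.
Qed.

(** Termwise integration: the partial sums of the series, times B(b, a), are the
    integrals of the partial Taylor sums, and differ from the left-hand side by
    the integral of the Taylor remainder.  Dividing by B(b, a) <> 0 identifies
    the limit. *)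
Lemma Beta_exp_1F1 a b y : 0 < complex.Re a -> 0 < complex.Re b ->
  cint mu (fun u => cpospow b u * cpospow a (1 - u) * cexp ((1 - u)%:C * y)) =
  Beta b a * hyp1F1 a (a + b) y.
Proof.
move=> a0 b0; have ab0 : 0 < complex.Re (a + b) by rewrite cReD addr_gt0.
have ba0 : 0 < complex.Re (b + a) by rewrite addrC.
set I := cint mu _.
pose F u := cpospow b u * cpospow a (1 - u).
pose P n := \sum_(0 <= k < n) pochhammer a k / pochhammer (a + b) k *
  (y ^+ k / k`!%:R).
have B0 : Beta b a != 0.
  by rewrite Beta_Gamma// !mulf_neq0 ?invr_eq0 ?Gamma_neq0.
pose Q k u := y ^+ k / k`!%:R * (cpospow b u * cpospow (a + k%:R) (1 - u)).
have ak0 k : 0 < complex.Re (a + k%:R) by rewrite cReD Re_nat ltr_wpDr.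
have iQ k : cintegrable mu (Q k) by apply: cintegrableM;
  exact: cintegrable_beta.
have FE n u : F u * expsum n ((1 - u)%:C * y) = \sum_(0 <= k < n) Q k u.
  rewrite /expsum mulr_sumr; apply: eq_bigr => k _.
  by rewrite /F /Q -cpospow_shift exprMn; ring.
have iS n := (cintegrable_sum n iQ).1.
have PE n : cint mu (fun u => \sum_(0 <= k < n) Q k u) = Beta b a * P n.
  rewrite (cintegrable_sum n iQ).2 mulr_sumr; apply: eq_bigr => k _.
  rewrite /Q cintZ; last exact: cintegrable_beta.
  by rewrite -/(Beta _ _) Beta_shift//; ring.
pose K := 2 * expR `|complex.Re y|; pose M := `|complex.Re y| + `|complex.Im y|.
pose f u := rpospow (complex.Re b) u * rpospow (complex.Re a) (1 - u).
have i_f : mu.-integrable setT (EFin \o f) by exact: integrable_beta.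
pose r n u := F u * (cexp ((1 - u)%:C * y) - expsum n ((1 - u)%:C * y)).
(* The Taylor bound only holds on ]0, 1[, but F vanishes elsewhere. *)
have rle n u : Normc.normc (r n u) <= (K * exp_coeff M n) * f u.
  have fF : f u = Normc.normc (F u) by rewrite Normc.normcM !normc_cpospow.
  rewrite Normc.normcM -fF mulrC; have [u01|u01] := boolP ((0 < u) && (u < 1)).
    rewrite ler_wpM2r ?fF ?normc_ge0// Taylor_cexp//.
    by move: u01 => /andP[u0 u1]; lra.
  by rewrite [f u]beta_eq0// !mulr0.
have iE := cintegrable_beta_exp y a0 b0.
have rE n : r n = (fun u => F u * cexp ((1 - u)%:C * y) - \sum_(0 <= k < n) Q k
  u).
  by apply/funext => u; rewrite /r mulrBr FE.
have ir n : cintegrable mu (r n) by rewrite rE; exact: cintegrableB.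
have IE n : cint mu (r n) = I - Beta b a * P n by rewrite rE cintB// PE.
pose d n := (K * exp_coeff M n * \int[mu]_u f u) *+ 2.
have d0 : d @ \oo --> 0.
  rewrite (_ : d = (fun n => (K * \int[mu]_u f u) *+ 2 * exp_coeff M n)).
    rewrite -[X in _ --> X](mulr0 ((K * \int[mu]_u f u) *+ 2)).
    by apply: cvgM; [exact: cvg_cst|exact: cvg_exp_coeff].
  by apply/funext => n; rewrite /d !mulr2n; ring.
have ed n : Normc.normc (cint mu (r n)) <= d n.
  have ig : mu.-integrable setT (EFin \o (fun u => K * exp_coeff M n * f u)).
    by have := integrableZl measurableT (K * exp_coeff M n) i_f.
  have [h1 h2] := normr_cint_le (ir n) ig (rle n).
  rewrite (le_trans (normc_le_ReIm _))// /d mulr2n -RintegralZl//; exact: lerD.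
have Pcv : (P : nat -> R[i]^o) @ \oo --> (I / Beta b a : R[i]^o).
  apply: (@cvg_complex P (I / Beta b a) (fun n =>
    Normc.normc (Beta b a)^-1 * d n)).
    rewrite -[X in _ --> X](mulr0 (Normc.normc (Beta b a)^-1)).
    by apply: cvgM; [exact: cvg_cst|exact: d0].
  move=> n; rewrite (_ : _ - _ = (Beta b a)^-1 * cint mu (r n)).
    by rewrite Normc.normcM ler_wpM2l// normc_ge0.
  by rewrite IE; field.
have -> : hyp1F1 a (a + b) y = I / Beta b a by exact: (cvg_lim _ Pcv).
by rewrite mulrCA mulfV// mulr1.
Qed.

End Kummer.

(** * The integral defining the extended Bessel function *)

Section Assembly.
Variable R : realType.
Notation mu := (@lebesgue_measure R).
Implicit Types (a b v q x y : R[i]).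

(** The endpoints are excluded from the hypothesis: the principal powers at base
    0 need not agree with the extensions by 0. *)
Lemma cintegral_itvcc (g G : R -> R[i]) (c d : R) : cintegrable mu G ->
  (forall t, c < t < d -> g t = G t) -> (forall t, ~~ (c < t < d) -> G t = 0) ->
  cintegral `[c, d] g = cint mu G.
Proof.
move=> [i1 i2] gG G0.
have part (h H : R -> R) : mu.-integrable setT (EFin \o H) ->
    (forall t, c < t < d -> h t = H t) ->
    (forall t, ~~ (c < t < d) -> H t = 0) ->
    \int[mu]_(t in `[c, d]) h t = \int[mu]_t H t.
  move=> iH hH H0; have mH := measurable_int mu iH.
  have mh : measurable_fun `]c, d[ (EFin \o h).
    apply: (@eq_measurable_fun _ _ _ _ _ (EFin \o H));
      last exact: measurable_funTS.
    by move=> t; rewrite inE/= in_itv/= => /hH ->.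
  have -> : \int[mu]_(t in `[c, d]) h t = \int[mu]_(t in `]c, d[) h t.
    by rewrite /Rintegral (integral_itv_bndoo _ _ mh).
  rewrite Rintegral_mkcond; apply: eq_Rintegral => t _; rewrite patchE.
  case: ifPn; first by rewrite inE/= in_itv/= => /hH.
  by rewrite notin_setE/= in_itv/= => /negP /H0 ->.
rewrite /cintegral /cint; congr Complex; apply: part => //.
- by move=> t tcd; rewrite gG.
- by move=> t tcd; rewrite G0.
- by move=> t tcd; rewrite gG.
- by move=> t tcd; rewrite G0.
Qed.

Lemma bessel_integral v q x : 0 < complex.Re (v + q) -> - 2^-1 < complex.Re v ->
  cintegral `[-1, 1] (fun t =>
    cpow (1 - t%:C ^+ 2) (v - 2^-1) * cpow (1 - t%:C) (q - 2^-1) *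
    cexp (- x * (t%:C - 1))) =
  cpow 2 (2 * v + q - 2^-1) *
  cint mu (fun u => cpospow (v + 2^-1) u * cpospow (v + q) (1 - u) * cexp
    ((1 - u)%:C * (2 * x))).
Proof.
move=> a0 v0; set a := v + q in a0 *; set b := v + 2^-1.
have halfC : (2^-1 : R)%:C = 2^-1 :> R[i] by rewrite fmorphV/= real_complex_nat.
have b0 : 0 < complex.Re b by rewrite /b -halfC cReD /=; lra.
have one : (1 : R)%:C = 1 :> R[i] by [].
have two : 2 = (2 : R)%:C :> R[i] by rewrite real_complex_nat.
pose H u := cpospow b u * cpospow a (1 - u) * cexp ((1 - u)%:C * (2 * x)).
have iH : cintegrable mu H by exact: cintegrable_beta_exp.
pose G t := cpospow b (1 + t) * cpospow a (1 - t) * cexp ((1 - t)%:C * x).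
pose c := cexp ((a + b - 2) * (ln 2)%:C).
have h0 : 0 < 2^-1 :> R by rewrite invr_gt0.
(* The powers are homogeneous, which brings out 2^(a+b-2); the Jacobian of the
   substitution contributes the remaining factor 2. *)
have GE t : G t = c * H (2^-1 * t + 2^-1).
  have e1 : 1 + t = 2 * (2^-1 * t + 2^-1) by field.
  have e2 : 1 - t = 2 * (1 - (2^-1 * t + 2^-1)) by field.
  have e3 : (1 - t)%:C * x = (1 - (2^-1 * t + 2^-1))%:C * (2 * x).
    by rewrite e2 rmorphM/= real_complex_nat; ring.
  rewrite /G /H e3 e1 e2 !cpospow_scale// /c.
  rewrite (_ : (a + b - 2) * (ln 2)%:C = (b - 1) * (ln 2)%:C + (a - 1) *
    (ln 2)%:C); last by ring.
  by rewrite cexpD; ring.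
have iG : cintegrable mu G.
  rewrite (_ : G = fun t => c * H (2^-1 * t + 2^-1)); last by apply/funext.
  by apply: cintegrableM; exact: cintegrable_affine.
rewrite (@cintegral_itvcc _ G _ _ iG).
- rewrite (cint_affine 2^-1 h0 iH) (_ : G = fun t => c * H (2^-1 * t + 2^-1));
    last by apply/funext.
  rewrite cintZ; last exact: cintegrable_affine.
  rewrite mulrA; congr (_ * _).
  rewrite [X in cpow X]two cpow_gt0// (_ : (2^-1 : R)%:C = cexp (- (ln 2)%:C));
    last first.
    by rewrite -rmorphN cexp_real expRN lnK ?posrE.
  rewrite -cexpD /c /a /b; congr cexp.
  by field.
- move=> t /andP[t1 t2].
  have p0 : 0 < 1 + t by lra.
  have m0 : 0 < 1 - t by lra.
  have -> : 1 - t%:C ^+ 2 = ((1 - t) * (1 + t))%:C.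
    by rewrite rmorphM rmorphB rmorphD/= one; ring.
  have -> : 1 - t%:C = (1 - t)%:C by rewrite rmorphB.
  rewrite !cpow_gt0 ?mulr_gt0// /G /cpospow p0 m0 -!cexpD; congr cexp.
  by rewrite lnM// rmorphD rmorphB/= one /a /b; field.
- move=> t; rewrite negb_and -!leNgt /G /cpospow => /orP[t1|t1].
    by rewrite ltNge (_ : 1 + t <= 0) ?mul0r//; lra.
  by rewrite [0 < 1 - t]ltNge (_ : 1 - t <= 0) ?mulr0 ?mul0r//; lra.
Qed.


End Assembly.

Theorem theorem4 (R : realType) (v q x : R[i])
    (hvq : 0 < complex.Re (v + q)) (hv : - 2^-1 < complex.Re v)
    (hx : x != 0) :
  ext_bessel_I v q x =
    cpow (x / 2) v * cpow 2 (2 * v + q - 2^-1) * Gamma (v + q) /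
      ((Num.sqrt (pi : R))%:C * Gamma (2 * v + q + 2^-1)) *
    hyp1F1 (v + q) (2 * v + q + 2^-1) (2 * x).
Proof.
rewrite /ext_bessel_I bessel_integral//.
have b0 : 0 < complex.Re (v + 2^-1).
  have <- : (2^-1 : R)%:C = 2^-1 :> R[i] by rewrite fmorphV/= real_complex_nat.
  by rewrite cReD /=; lra.
have abE : v + q + (v + 2^-1) = 2 * v + q + 2^-1 by ring.
have ab0 : 0 < complex.Re (2 * v + q + 2^-1) by rewrite -abE cReD addr_gt0.
rewrite Beta_exp_1F1// Beta_Gamma// [v + 2^-1 + _]addrC abE.
have sp : (Num.sqrt (pi : R))%:C != 0.
  by rewrite -[0]/(0%:C) (inj_eq (@complexI R)) gt_eqF// sqrtr_gt0 pi_gt0.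
have := Gamma_neq0 b0; have := Gamma_neq0 ab0.
move: (Gamma _) (Gamma (v + _)) (hyp1F1 _ _ _) sp => g gb h sp g0 gb0.
by field; rewrite sp g0 gb0.
Qed.
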